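(* Suppose $E,F$ are two Hilbert spaces with fixed finite orthonormal bases $\{e_1,\dots,e_m\}\subset E$ and $\{f_1,\dots,f_n\}\subset F$, and $u:F\otimes E\to E\otimes F$ is a unitary operator. Let $\left(u_{(k,l),(i,j)}\right)$ be defined by $u(f_j\otimes e_i)=\sum_{k=1}^m\sum_{l=1}^n u_{(k,l),(i,j)}\,e_k\otimes f_l$, and for $1\le i\le m$, $1\le j\le n$ let $$P_{i,j}=w_jz_i-\sum_{k=1}^m\sum_{l=1}^n u_{(k,l),(i,j)}z_kw_l\in\mathcal P_{m,n}=\mathbb C\langle z_1,\dots,z_m,w_1,\dots,w_n\rangle .$$ Then there is an inclusion-reversing bijection between the following collections: (i) standard subproduct systems $X$ over $\mathbb N^2$ that have $u$ as a commutation relation and satisfy $X(1,0)\subset E$, $X(0,1)\subset F$; (ii) proper $(m,n)$-homogeneous (two-sided) ideals in $\mathcal P_{m,n}$ that contain all of $\{P_{i,j}\}$.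
   Context: $\mathbb N=\{0,1,2,\dots\}$. A subproduct system (over $\mathbb N^2$) is a family $X=\{X(s)\}_{s\in\mathbb N^2}$ of finite-dimensional complex Hilbert spaces with $\dim X(0)=1$ (so $X(0)=\mathbb C$), together with coisometries $U_{s,t}:X(s)\otimes X(t)\to X(s+t)$, such that $U_{s,0},U_{0,s}$ are the natural isomorphisms and $U_{s+t,r}(U_{s,t}\otimes I_{X(r)})=U_{s,t+r}(I_{X(s)}\otimes U_{t,r})$ for all $s,t,r$. For a unitary $u:F\otimes E\to E\otimes F$ put $u^{(1,k)}=(I_{E^{\otimes(k-1)}}\otimes u)(I_{E^{\otimes(k-2)}}\otimes u\otimes I_E)\cdots(u\otimes I_{E^{\otimes(k-1)}}):F\otimes E^{\otimes k}\to E^{\otimes k}\otimes F$ and $u^{(j,k)}=(u^{(1,k)}\otimes I_{F^{\otimes(j-1)}})\cdots(I_{F^{\otimes(j-1)}}\otimes u^{(1,k)}):F^{\otimes j}\otimes E^{\otimes k}\to E^{\otimes k}\otimes F^{\otimes j}$ (identity if $j=0$ or $k=0$), and $W^u_{(i,j),(k,l)}=I_{E^{\otimes i}}\otimes u^{(j,k)}\otimes I_{F^{\otimes l}}:E^{\otimes i}\otimes F^{\otimes j}\otimes E^{\otimes k}\otimes F^{\otimes l}\to E^{\otimes(i+k)}\otimes F^{\otimes(j+l)}$. A standard subproduct system $X$ with $X(1,0)\subset E$, $X(0,1)\subset F$ having $u$ as a commutation relation is a subproduct system consisting of subspaces $X(i,j)\subset E^{\otimes i}\otimes F^{\otimes j}$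 ($X(0,0)=\mathbb C$) such that, with $p_{(i,j)}$ the orthogonal projection of $E^{\otimes i}\otimes F^{\otimes j}$ onto $X(i,j)$, for all $(i,j),(k,l)\in\mathbb N^2$: $U_{(i,j),(k,l)}=p_{(i+k,j+l)}W^u_{(i,j),(k,l)}|_{X(i,j)\otimes X(k,l)}$, $p_{(i+k,j+l)}\le W^u_{(i,j),(k,l)}(p_{(i,j)}\otimes I)(W^u_{(i,j),(k,l)})^*$, and $p_{(i+k,j+l)}\le W^u_{(i,j),(k,l)}(I\otimes p_{(k,l)})(W^u_{(i,j),(k,l)})^*$. Inclusion of such systems means $X(i,j)\subset X'(i,j)$ for all $(i,j)$. $\mathcal P_{m,n}$ is the free unital complex algebra (non-commutative polynomials). $P\in\mathcal P_{m,n}$ is $(m,n)$-homogeneous of degree $(d_m,d_n)$ if it is a sum of (scalar multiples of) non-commutative monomials each containing exactly $d_m$ letters from $\{z_1,\dots,z_m\}$ and $d_n$ letters from $\{w_1,\dots,w_n\}$, counted with multiplicity, in any order. An ideal is $(m,n)$-homogeneous if it is generated by $(m,n)$-homogeneous non-commutative polynomials. *)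

(* Defs.v *)
From HB Require Import structures.
From mathcomp Require Import all_boot all_order all_algebra.
From mathcomp Require Import finmap.
From mathcomp Require Import sesquilinear complex.
From mathcomp Require Import classical_sets functions reals.
From mathcomp.multinomials Require Import monalg.

Set Implicit Arguments.
Unset Strict Implicit.
Unset Printing Implicit Defensive.

Import Order.TTheory GRing.Theory Num.Theory.
Local Open Scope ring_scope.

(* ell2 C A is the finite-dimensional Hilbert space over C with an orthonormal
   basis (delta a) indexed by the finite type A.  A Hilbert space with a fixed
   orthonormal basis indexed by A is identified with ell2 C A; accordingly
   ell2 A (x) ell2 B is ell2 (A * B), with delta a (x) delta b = delta (a, b). *)
Notation ell2 C A := {ffun A -> C^o}.

Section Hilbert.
Variable C : numClosedFieldType.
Implicit Types A B D : finType.

Definition delta A (a : A) : ell2 C A := [ffun a' => (a' == a)%:R].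

Definition inner A (x y : ell2 C A) : C := \sum_a x a * (y a)^*.

Lemma inner_bilinear A :
  bilinear_for *%R (Num.conj \; *%R) (@inner A).
Proof.
split=> [y k x x'|x k y y']; rewrite /inner /= mulr_sumr -big_split /=;
  apply: eq_bigr => a _; rewrite !ffunE.
  by rewrite mulrDl -mulrA.
by rewrite rmorphD rmorphM mulrDr mulrCA.
Qed.
HB.instance Definition _ A := bilinear_isBilinear.Build C _ _ _ _ _ (@inner A)
  (@inner_bilinear A).

Lemma inner_hermitian A (x y : ell2 C A) :
  inner x y = (-1) ^+ false * (inner y x)^*.
Proof.
rewrite expr0 mul1r /inner rmorph_sum; apply: eq_bigr => a _.
by rewrite rmorphM /= conjCK mulrC.
Qed.
HB.instance Definition _ A := isHermitianSesquilinear.Build C _ _ _ (@inner A)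
  (@inner_hermitian A).

Lemma inner_gt0 A (x : ell2 C A) : x != 0 -> 0 < inner x x.
Proof.
move=> x0; rewrite lt_def sumr_ge0 ?andbT => [|a _]; last exact: mul_conjC_ge0.
apply: contra x0; rewrite psumr_eq0 => [/allP x0|a _]; last exact: mul_conjC_ge0.
apply/eqP/ffunP => a; rewrite ffunE; apply/eqP.
by rewrite -mul_conjC_eq0; apply: x0; rewrite mem_index_enum.
Qed.
HB.instance Definition _ A := isDotProduct.Build C _ (@inner A) (@inner_gt0 A).

(* The operator whose matrix entry <T (delta a), delta b> is M a b. *)
Definition mxop A B (M : A -> B -> C) : 'Hom(ell2 C A, ell2 C B) :=
  linfun (fun x : ell2 C A => [ffun b => \sum_a x a * M a b] : ell2 C B).

Definition entry A B (T : 'Hom(ell2 C A, ell2 C B)) (a : A) (b : B) : C :=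
  T (delta a) b.

Definition relabel A B (h : A -> B) : 'Hom(ell2 C A, ell2 C B) :=
  mxop (fun a b => (h a == b)%:R).

Definition adj A B (T : 'Hom(ell2 C A, ell2 C B)) : 'Hom(ell2 C B, ell2 C A) :=
  mxop (fun b a => (entry T a b)^*).

Definition tensor A B (x : ell2 C A) (y : ell2 C B) : ell2 C (A * B)%type :=
  [ffun ab => x ab.1 * y ab.2].

Definition tensop A A' B B' (S : 'Hom(ell2 C A, ell2 C B))
    (T : 'Hom(ell2 C A', ell2 C B')) :
    'Hom(ell2 C (A * A')%type, ell2 C (B * B')%type) :=
  mxop (fun a b => entry S a.1 b.1 * entry T a.2 b.2).

Definition tensv A B (V : {vspace ell2 C A}) (V' : {vspace ell2 C B}) :
    {vspace ell2 C (A * B)%type} :=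
  <<[seq tensor x y | x <- vbasis V, y <- vbasis V']>>%VS.

Definition unitary_op A B (T : 'Hom(ell2 C A, ell2 C B)) : Prop :=
  (adj T \o T = \1)%VF /\ (T \o adj T = \1)%VF.

Definition oproj A (V : {vspace ell2 C A}) : 'End(ell2 C A) :=
  daddv_pi V (orthov (@inner A) V).

Definition le_op A (S T : 'End(ell2 C A)) : Prop :=
  forall x, 0 <= inner ((T - S) x) x.

(* T, restricted to V, is a coisometry from V onto W: it maps V to W and, for
   its adjoint Ts : W -> V, T Ts is the identity of W. *)
Definition coisometry A B (V : {vspace ell2 C A}) (W : {vspace ell2 C B})
    (T : 'Hom(ell2 C A, ell2 C B)) : Prop :=
  (T @: V <= W)%VS /\
  exists Ts : 'Hom(ell2 C B, ell2 C A),
    [/\ (Ts @: W <= V)%VS,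
        {in V & W, forall x y, inner (T x) y = inner x (Ts y)} &
        {in W, forall y, T (Ts y) = y}].

Lemma mxopE A B (M : A -> B -> C) x b : mxop M x b = \sum_a x a * M a b.
Proof.
pose f (x : ell2 C A) : ell2 C B := [ffun b => \sum_a x a * M a b].
have fl : linear f.
  move=> k y z; apply/ffunP => b'; rewrite !ffunE /= scaler_sumr -big_split /=.
  by apply: eq_bigr => a _; rewrite !ffunE mulrDl -scalerAl.
pose L := GRing.isLinear.Build _ _ _ _ f fl.
pose f' : {linear _ -> _} := HB.pack f L.
by rewrite /mxop -[linfun _]/(linfun f') lfunE /= ffunE.
Qed.

Lemma delta_sum A (x : ell2 C A) : x = \sum_a x a *: delta a.
Proof.
apply/ffunP => b; rewrite sum_ffunE (bigD1 b) //= !ffunE eqxx.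
rewrite big1 => [|a ab]; first by rewrite addr0 [RHS]mulr1.
by rewrite !ffunE eq_sym (negPf ab) scaler0.
Qed.

Lemma lfun_entryE A B (T : 'Hom(ell2 C A, ell2 C B)) x b :
  T x b = \sum_a x a * entry T a b.
Proof.
rewrite {1}[x]delta_sum linear_sum sum_ffunE; apply: eq_bigr => a _.
by rewrite linearZ ffunE.
Qed.

Lemma relabel_delta A B (h : A -> B) a : relabel h (delta a) = delta (h a).
Proof.
apply/ffunP => b; rewrite mxopE (bigD1 a) //= !ffunE eqxx mul1r.
rewrite big1 ?addr0 1?eq_sym // => a' /negPf a'a.
by rewrite ffunE a'a mul0r.
Qed.

Lemma adjP A B (T : 'Hom(ell2 C A, ell2 C B)) x y :
  inner (T x) y = inner x (adj T y).
Proof.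
rewrite /inner.
under eq_bigr do rewrite lfun_entryE mulr_suml.
under [RHS]eq_bigr do rewrite mxopE rmorph_sum mulr_sumr.
rewrite exchange_big; apply: eq_bigr => a _; apply: eq_bigr => b _.
by rewrite rmorphM /= conjCK mulrAC mulrA.
Qed.

Lemma tensopE A A' B B' (S : 'Hom(ell2 C A, ell2 C B))
    (T : 'Hom(ell2 C A', ell2 C B')) x y :
  tensop S T (tensor x y) = tensor (S x) (T y).
Proof.
apply/ffunP => -[b b']; rewrite mxopE ffunE /= !lfun_entryE mulr_suml.
rewrite (eq_bigr (fun p => (x p.1 * y p.2) *
  (entry S p.1 b * entry T p.2 b'))); last by move=> p _; rewrite ffunE.
rewrite -(pair_bigA _ (fun a a' => (x a * y a') *
  (entry S a b * entry T a' b'))) /=.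
apply: eq_bigr => a _; rewrite mulr_sumr; apply: eq_bigr => a' _.
by rewrite mulrACA.
Qed.

Lemma oproj_mem A (V : {vspace ell2 C A}) x : oproj V x \in V.
Proof. exact: memv_pi. Qed.

Lemma orthov_direct A (V : {vspace ell2 C A}) :
  (V :&: orthov (@inner A) V = 0)%VS.
Proof.
apply/eqP; rewrite -subv0; apply/subvP => z; rewrite memv_cap memv0.
case/andP=> zV /mem_orthovP/(_ z zV) zz.
by apply/negPn/negP => /inner_gt0; rewrite zz ltxx.
Qed.

Lemma orthov_full A (V : {vspace ell2 C A}) :
  (V + orthov (@inner A) V = fullv)%VS.
Proof.
set W := orthov _ V; pose k := \dim V.
pose f (x : ell2 C A) : ell2 C 'I_k := [ffun i => inner x (vbasis V)`_(val i)].
have fl : linear f.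
  by move=> c y z; apply/ffunP => i; rewrite !ffunE (inner_bilinear A).1.
pose L := GRing.isLinear.Build _ _ _ _ f fl.
pose g : {linear _ -> _} := HB.pack f L.
have kerW : (lker (linfun g) <= W)%VS.
  apply/subvP => x; rewrite memv_ker lfunE /= => /eqP fx0.
  apply/mem_orthovP => v /coord_vbasis ->; rewrite linear_sumr big1 // => i _.
  rewrite linearZ /= -[inner _ _](ffunE (fun i : 'I_k => inner x _`_(val i))).
  by rewrite -/(f x) fx0 ffunE mulr0.
apply/eqP; rewrite eqEdim subvf /= dimv_disjoint_sum ?orthov_direct //.
rewrite -(limg_ker_dim (linfun g) fullv) addnC leq_add //.
  rewrite (leq_trans (dimvS (subvf _))) // dimvf /dim /= card_ord.
  by rewrite muln1.
by rewrite capfv dimvS.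
Qed.

Lemma oproj_orth A (V : {vspace ell2 C A}) x y :
  y \in V -> inner (x - oproj V x) y = 0.
Proof.
move=> yV; have := @daddv_pi_add _ _ _ _ x (orthov_direct V).
rewrite orthov_full memvf => /(_ isT) e.
have -> : x - oproj V x = daddv_pi (orthov (@inner A) V) V x.
  by apply/eqP; rewrite subr_eq addrC e.
exact: (mem_orthovP (memv_pi _ _ _)).
Qed.

End Hilbert.

Arguments delta {C A} a.
Arguments relabel {C A B} h.

(* C<z_1..z_m, w_1..w_n>, the algebra of the free monoid on 'I_m + 'I_n;
   inl i is the letter z_i and inr j is the letter w_j. *)
Notation ncpoly C m n := {malg C[{fmonom ('I_m + 'I_n)%type}]}.

Section Subproduct.
Variables (C : numClosedFieldType) (m n : nat).

Definition deg : Type := (nat * nat)%type.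
Definition addd (s t : deg) : deg := (s.1 + t.1, s.2 + t.2)%N.

(* words (i, j) indexes the basis (e_a (x) f_b) of E^(x)i (x) F^(x)j, where
   E = ell2 'I_m and F = ell2 'I_n. *)
Definition words (s : deg) : finType :=
  ((s.1).-tuple 'I_m * (s.2).-tuple 'I_n)%type.

Definition cast_words (s t : deg) (e : (s.1 = t.1) * (s.2 = t.2))
    (x : words s) : words t := (tcast e.1 x.1, tcast e.2 x.2).

Definition subspace_family : Type := forall s : deg, {vspace ell2 C (words s)}.

Implicit Types X : subspace_family.

Section Commutation.
Variable u : 'Hom(ell2 C ('I_n * 'I_m)%type, ell2 C ('I_m * 'I_n)%type).

(* u^(1,k) : F (x) E^(x)k -> E^(x)k (x) F, via
   u^(1,k+1) = (I_E (x) u^(1,k)) (u (x) I_{E^(x)k}). *)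
Fixpoint comm1 (k : nat) : 'Hom(ell2 C ('I_n * k.-tuple 'I_m)%type,
                                ell2 C (k.-tuple 'I_m * 'I_n)%type) :=
  match k with
  | 0 => relabel (fun x => (x.2, x.1))
  | k'.+1 =>
    (relabel (fun x : 'I_m * (k'.-tuple 'I_m * 'I_n) =>
        ([tuple of x.1 :: x.2.1], x.2.2))
     \o tensop \1 (comm1 k')
     \o relabel (fun x : ('I_m * 'I_n) * k'.-tuple 'I_m =>
          (x.1.1, (x.1.2, x.2)))
     \o tensop u \1
     \o relabel (fun x : 'I_n * k'.+1.-tuple 'I_m =>
          ((x.1, thead x.2), [tuple of behead x.2])))%VF
  end.

(* u^(j,k) : F^(x)j (x) E^(x)k -> E^(x)k (x) F^(x)j, via
   u^(j+1,k) = (u^(1,k) (x) I_{F^(x)j}) (I_F (x) u^(j,k)). *)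
Fixpoint comm (j k : nat) :
    'Hom(ell2 C (j.-tuple 'I_n * k.-tuple 'I_m)%type,
         ell2 C (k.-tuple 'I_m * j.-tuple 'I_n)%type) :=
  match j with
  | 0 => relabel (fun x => (x.2, x.1))
  | j'.+1 =>
    (relabel (fun x : (k.-tuple 'I_m * 'I_n) * j'.-tuple 'I_n =>
        (x.1.1, [tuple of x.1.2 :: x.2]))
     \o tensop (comm1 k) \1
     \o relabel (fun x : 'I_n * (k.-tuple 'I_m * j'.-tuple 'I_n) =>
          ((x.1, x.2.1), x.2.2))
     \o tensop \1 (comm j' k)
     \o relabel (fun x : j'.+1.-tuple 'I_n * k.-tuple 'I_m =>
          (thead x.1, ([tuple of behead x.1], x.2))))%VF
  end.

Definition Wop (s t : deg) :
    'Hom(ell2 C (words s * words t)%type, ell2 C (words (addd s t))) :=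
  (relabel (fun x : (s.1).-tuple 'I_m *
       (((t.1).-tuple 'I_m * (s.2).-tuple 'I_n) * (t.2).-tuple 'I_n) =>
       ([tuple of x.1 ++ x.2.1.1], [tuple of x.2.1.2 ++ x.2.2])
       : words (addd s t))
   \o tensop \1 (tensop (comm s.2 t.1) \1)
   \o relabel (fun x : words s * words t =>
        (x.1.1, ((x.1.2, x.2.1), x.2.2))))%VF.

End Commutation.

Definition assocd (s t r : deg) :=
  (addnA s.1 t.1 r.1, addnA s.2 t.2 r.2).
Definition unitd (s : deg) := (esym (addn0 s.1), esym (addn0 s.2)).

(* U s t is an operator on the ambient space whose restriction to
   X s (x) X t is the structure map of the system.  The space
   ell2 C (words (0, 0)) is one-dimensional, with basis vector the pair of
   empty words; it is the copy of the scalar field in which X (0, 0) lives. *)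
Definition subproduct_system X
    (U : forall s t : deg,
       'Hom(ell2 C (words s * words t)%type, ell2 C (words (addd s t)))) : Prop :=
  [/\ X (0, 0)%N = fullv,
      forall s t, coisometry (tensv (X s) (X t)) (X (addd s t)) (U s t),
      forall s, {in tensv (X s) (X (0, 0)%N), forall x,
        U s (0, 0)%N x =
        relabel (fun a : words s * words (0, 0)%N =>
          cast_words (t := addd s (0, 0)%N) (unitd s) a.1) x},
      forall s, {in tensv (X (0, 0)%N) (X s), forall x,
        U (0, 0)%N s x =
        relabel (fun a : words (0, 0)%N * words s =>
          a.2 : words (addd (0, 0)%N s)) x} &
      forall s t r, {in tensv (tensv (X s) (X t)) (X r), forall x,
        U (addd s t) r (tensop (U s t) \1%VF x) =
        relabel (cast_words (s := addd s (addd t r)) (t := addd (addd s t) r)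
                   (assocd s t r))
          (U s (addd t r) (tensop \1%VF (U t r)
            (relabel (fun a : (words s * words t) * words r =>
               (a.1.1, (a.1.2, a.2))) x)))}].

Definition standard_subproduct_system
    (u : 'Hom(ell2 C ('I_n * 'I_m)%type, ell2 C ('I_m * 'I_n)%type)) X : Prop :=
  [/\ subproduct_system X (fun s t => oproj (X (addd s t)) \o Wop u s t)%VF,
      forall s t, le_op (oproj (X (addd s t)))
        (Wop u s t \o tensop (oproj (X s)) \1 \o adj (Wop u s t))%VF &
      forall s t, le_op (oproj (X (addd s t)))
        (Wop u s t \o tensop \1 (oproj (X t)) \o adj (Wop u s t))%VF].

Definition subsystem X X' : Prop := forall s, (X s <= X' s)%VS.

Local Notation ncpoly := (ncpoly C m n).

Definition zvar (i : 'I_m) : ncpoly := << fmu (inl i) >>.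
Definition wvar (j : 'I_n) : ncpoly := << fmu (inr j) >>.

Definition homogeneous (p : ncpoly) (dm dn : nat) : Prop :=
  forall w, w \in msupp p ->
    count (@is_inl _ _) w = dm /\ count (predC (@is_inl _ _)) w = dn.

Local Open Scope classical_set_scope.
Implicit Types I G : set ncpoly.

Definition two_sided_ideal I : Prop :=
  [/\ I 0, forall p q, I p -> I q -> I (p + q) &
      forall p q, I p -> I (q * p) /\ I (p * q)].

Definition homogeneous_ideal I : Prop :=
  exists G, (forall p, G p -> exists dm dn, homogeneous p dm dn) /\
    I = smallest two_sided_ideal G.

Definition proper_two_sided_ideal I : Prop := two_sided_ideal I /\ I <> setT.

Definition commutation_poly
    (u : 'Hom(ell2 C ('I_n * 'I_m)%type, ell2 C ('I_m * 'I_n)%type))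
    (i : 'I_m) (j : 'I_n) : ncpoly :=
  wvar j * zvar i -
  \sum_(k < m) \sum_(l < n) u (delta (j, i)) (k, l) *: (zvar k * wvar l).

End Subproduct.

(* Main.v *)
Require Import Defs.
From HB Require Import structures.
From mathcomp Require Import all_boot all_order all_algebra.
From mathcomp Require Import finmap sesquilinear complex.
From mathcomp Require Import classical_sets boolp functions reals.
From mathcomp.multinomials Require Import monalg.

(** The correspondence sends a standard system [X] to the ideal of all polynomials
    whose normally ordered form is orthogonal to [X] in every degree.

    Write [H_s] for [E^(x)i (x) F^(x)j], [s = (i, j)], and identify it with the span of the
    normally ordered words [z_a w_b] of degree [s]. Modulo the commutation polynomials
    every word is congruent to an element of some [H_s], because [u] exchanges a letter
    [w] with a letter [z] to its right. The operators [W_(s,t)] perform these exchanges,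
    so that [W_(s,t) (x (x) y)] is the product [x y] reduced to normal form
    ([intertwines_Wop], [embed_Wop]). Normal forms are moreover unique
    ([embed_congr_inj]): there is a representation of the free algebra that kills the
    commutation polynomials and under which a normally ordered word applied to [1] gives
    that word back. Hence the quotient of the free algebra by the commutation polynomials
    is the graded algebra [A], the direct sum of the [H_s] with product [W]; the unit laws
    and associativity of [W] come for free. Homogeneous ideals of the free algebra that
    contain the commutation polynomials are therefore the same thing as graded ideals of
    [A] ([pullback_ideal], [homogeneous_ideal_pullback]), and such an ideal is proper
    exactly when it meets the scalars [H_(0,0)] trivially ([pullback_proper]).

    On the other side, [W] is a coisometry since [u] is unitary. For a family of
    subspaces [X(s)] of [H_s] with projections [p_s], the inequality
    [p_(s+t) <= W (p_s (x) 1) W^*] means that [W^*] maps [X(s+t)] into [X(s) (x) H_t];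
    passing to complements, it says that [W] maps [X(s)^perp (x) H_t] into
    [X(s+t)^perp]. With its mirror image, this is the statement that the complements
    [X(s)^perp] form a graded ideal of [A]. When they do, the compressions [p W] are
    automatically associative, unital and coisometric, so that nothing else is contained
    in the definition of a standard system except [X(0,0)^perp = 0] ([standardP]).

    The bijection is the composite of [X |-> X^perp] with the correspondence of ideals;
    it reverses inclusions because taking complements does. *)

Set Implicit Arguments.
Unset Strict Implicit.
Unset Printing Implicit Defensive.

Import Order.TTheory GRing.Theory Num.Theory.
Local Open Scope ring_scope.

(** * Operators, tensor products and projections on finite-dimensional Hilbert spaces *)
Section HilbertTheory.
Variable C : numClosedFieldType.
Implicit Types A B D E : finType.

Lemma eq_mxop A B (M M' : A -> B -> C) :
  (forall a b, M a b = M' a b) -> mxop M = mxop M'.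
Proof.
move=> eM; apply/lfunP => x; apply/ffunP => b.
by rewrite !mxopE; apply: eq_bigr => a _; rewrite eM.
Qed.

Lemma mxop_delta A B (M : A -> B -> C) a b : mxop M (delta a) b = M a b.
Proof.
rewrite mxopE (bigD1 a) //= ffunE eqxx mul1r big1 ?addr0 // => a' /negPf ne.
by rewrite ffunE ne mul0r.
Qed.

Lemma entry_mxop A B (M : A -> B -> C) a b : entry (mxop M) a b = M a b.
Proof. exact: mxop_delta. Qed.

Lemma eq_lfun_delta A (V : vectType C) (S T : 'Hom(ell2 C A, V)) :
  (forall a, S (delta a) = T (delta a)) -> S = T.
Proof.
move=> e; apply/lfunP => x; rewrite [x]delta_sum !linear_sum.
by apply: eq_bigr => a _; rewrite !linearZ /= e.
Qed.

Lemma innerBl A (x y z : ell2 C A) : inner (x - y) z = inner x z - inner y z.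
Proof. by rewrite addrC -scaleN1r (@inner_bilinear C A).1 /= mulN1r addrC. Qed.

Lemma innerC A (x y : ell2 C A) : inner x y = (inner y x)^*.
Proof. by rewrite inner_hermitian expr0 mul1r. Qed.

Lemma innerBr A (x y z : ell2 C A) : inner x (y - z) = inner x y - inner x z.
Proof. by rewrite innerC innerBl rmorphB /= -!innerC. Qed.

Lemma inner_eq0 A (x : ell2 C A) : inner x x = 0 -> x = 0.
Proof. by move=> xx; apply/eqP/negPn/negP => /inner_gt0; rewrite xx ltxx. Qed.

Lemma inner_ge0 A (x : ell2 C A) : 0 <= inner x x.
Proof. by apply: sumr_ge0 => a _; exact: mul_conjC_ge0. Qed.

Lemma inner_extr A (x y : ell2 C A) :
  (forall z, inner z x = inner z y) -> x = y.
Proof.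
by move=> e; apply/eqP; rewrite -subr_eq0; apply/eqP/inner_eq0; rewrite innerBr e subrr.
Qed.

Lemma adj_eq A B (T : 'Hom(ell2 C A, ell2 C B)) (S : 'Hom(ell2 C B, ell2 C A)) :
  (forall x y, inner (T x) y = inner x (S y)) -> adj T = S.
Proof.
by move=> e; apply/lfunP => y; apply: inner_extr => x; rewrite -adjP e.
Qed.

Lemma adj_comp A B D (S : 'Hom(ell2 C B, ell2 C D)) (T : 'Hom(ell2 C A, ell2 C B)) :
  adj (S \o T)%VF = (adj T \o adj S)%VF.
Proof. by apply: adj_eq => x y; rewrite !comp_lfunE !adjP. Qed.

Lemma adj_id A : adj (\1%VF : 'End(ell2 C A)) = \1%VF.
Proof. by apply: adj_eq => x y; rewrite !id_lfunE. Qed.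

Lemma adj_tensop A A' B B' (S : 'Hom(ell2 C A, ell2 C B))
    (T : 'Hom(ell2 C A', ell2 C B')) :
  adj (tensop S T) = tensop (adj S) (adj T).
Proof. by apply: eq_mxop => b a; rewrite /tensop !entry_mxop rmorphM. Qed.

Lemma tensor_delta A B (a : A) (b : B) :
  tensor (delta a : ell2 C A) (delta b) = delta (a, b).
Proof. by apply/ffunP => -[a' b']; rewrite !ffunE /= xpair_eqE -natrM mulnb. Qed.

(** The tensor product with the arguments swapped, so that linearity in the left
    factor is an instance of a linear structure on a function. *)
Definition tensorr A B (y : ell2 C B) (x : ell2 C A) : ell2 C (A * B)%type :=
  tensor x y.

Lemma tensor_linear A B (x : ell2 C A) : linear (@tensor C A B x).
Proof. by move=> c y y'; apply/ffunP => a; rewrite !ffunE mulrDr mulrCA. Qed.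

Lemma tensorr_linear A B (y : ell2 C B) : linear (@tensorr A B y).
Proof. by move=> c x x'; apply/ffunP => a; rewrite !ffunE mulrDl -mulrA. Qed.

HB.instance Definition _ A B x :=
  GRing.isLinear.Build C _ _ _ (@tensor C A B x) (tensor_linear x).
HB.instance Definition _ A B y :=
  GRing.isLinear.Build C _ _ _ (@tensorr A B y) (tensorr_linear y).

Lemma tensorrE A B (x : ell2 C A) (y : ell2 C B) : tensor x y = tensorr y x.
Proof. by []. Qed.

Lemma tensop_comp A A' B B' D D'
    (S : 'Hom(ell2 C B, ell2 C D)) (T : 'Hom(ell2 C B', ell2 C D'))
    (S' : 'Hom(ell2 C A, ell2 C B)) (T' : 'Hom(ell2 C A', ell2 C B')) :
  (tensop S T \o tensop S' T')%VF = tensop (S \o S')%VF (T \o T')%VF.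
Proof.
apply: eq_lfun_delta => -[a a'].
by rewrite -tensor_delta comp_lfunE !tensopE !comp_lfunE.
Qed.

Lemma tensop_compl A B D E (S : 'Hom(ell2 C B, ell2 C D))
    (T : 'Hom(ell2 C A, ell2 C B)) :
  tensop (S \o T)%VF (\1%VF : 'End(ell2 C E)) = (tensop S \1%VF \o tensop T \1%VF)%VF.
Proof. by rewrite tensop_comp comp_lfun1l. Qed.

Lemma tensop_compr A B D E (S : 'Hom(ell2 C B, ell2 C D))
    (T : 'Hom(ell2 C A, ell2 C B)) :
  tensop (\1%VF : 'End(ell2 C E)) (S \o T)%VF = (tensop \1%VF S \o tensop \1%VF T)%VF.
Proof. by rewrite tensop_comp comp_lfun1l. Qed.

Lemma tensop_id A B : tensop \1%VF \1%VF = (\1%VF : 'End(ell2 C (A * B)%type)).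
Proof.
by apply: eq_lfun_delta => -[a b]; rewrite -tensor_delta tensopE !id_lfunE.
Qed.

Lemma relabel_id A : relabel id = \1%VF :> 'End(ell2 C A).
Proof. by apply: eq_lfun_delta => a; rewrite relabel_delta id_lfunE. Qed.

Lemma relabel_tensor_fst A B D (h : A -> D) x (b : B) :
  relabel (fun ab => h ab.1) (tensor x (delta b)) = relabel h x :> ell2 C D.
Proof.
suff <- : (relabel (fun ab => h ab.1) \o linfun (tensorr (delta b)) =
    relabel h :> 'Hom(ell2 C A, ell2 C D))%VF by rewrite comp_lfunE lfunE.
apply: eq_lfun_delta => a.
by rewrite comp_lfunE lfunE /= -tensorrE tensor_delta !relabel_delta.
Qed.

Lemma relabel_tensor_snd A B D (h : B -> D) (a : A) x :
  relabel (fun ab => h ab.2) (tensor (delta a) x) = relabel h x :> ell2 C D.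
Proof.
suff <- : (relabel (fun ab => h ab.2) \o linfun (tensor (delta a)) =
    relabel h :> 'Hom(ell2 C B, ell2 C D))%VF by rewrite comp_lfunE lfunE.
apply: eq_lfun_delta => b.
by rewrite comp_lfunE lfunE /= tensor_delta !relabel_delta.
Qed.

(** The property of [u] that passes through all the constructions leading to
    [Wop u s t]; it makes [adj W] an isometric section of [W]. *)
Definition coisometric A B (T : 'Hom(ell2 C A, ell2 C B)) : Prop :=
  (T \o adj T = \1)%VF.

Lemma coisometric_id A : coisometric (\1%VF : 'End(ell2 C A)).
Proof. by rewrite /coisometric adj_id comp_lfun1l. Qed.

Lemma coisometric_comp A B D
    (S : 'Hom(ell2 C B, ell2 C D)) (T : 'Hom(ell2 C A, ell2 C B)) :
  coisometric S -> coisometric T -> coisometric (S \o T)%VF.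
Proof.
rewrite /coisometric => eS eT.
by rewrite adj_comp comp_lfunA -[X in (X \o _)%VF]comp_lfunA eT comp_lfun1r.
Qed.

Lemma coisometric_tensop A A' B B' (S : 'Hom(ell2 C A, ell2 C B))
    (T : 'Hom(ell2 C A', ell2 C B')) :
  coisometric S -> coisometric T -> coisometric (tensop S T).
Proof.
by rewrite /coisometric => eS eT; rewrite adj_tensop tensop_comp eS eT tensop_id.
Qed.

(** The adjoint of a relabelling by a bijection relabels by the inverse bijection. *)
Lemma coisometric_relabel A B (h : A -> B) g :
  cancel h g -> cancel g h -> coisometric (relabel h : 'Hom(ell2 C A, ell2 C B)).
Proof.
move=> hK gK; rewrite /coisometric.
have -> : adj (relabel h) = (relabel g : 'Hom(ell2 C B, ell2 C A)).
  by apply: eq_mxop => b a; rewrite entry_mxop conjC_nat -(can_eq gK) hK eq_sym.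
by apply: eq_lfun_delta => b; rewrite comp_lfunE !relabel_delta gK id_lfunE.
Qed.

Section Projection.
Variables (A : finType) (V : {vspace ell2 C A}).

Lemma oproj_id x : x \in V -> oproj V x = x.
Proof.
move=> xV; apply/eqP; rewrite eq_sym -subr_eq0; apply/eqP/inner_eq0.
by rewrite oproj_orth // rpredB // oproj_mem.
Qed.

Lemma mem_orthov_iff x : x \in orthov (@inner C A) V <-> {in V, forall y, inner x y = 0}.
Proof. by split=> /mem_orthovP. Qed.

Lemma oproj_compl x : x - oproj V x \in orthov (@inner C A) V.
Proof. by apply/mem_orthov_iff => y yV; rewrite oproj_orth. Qed.

Lemma oproj_self x y : inner (oproj V x) y = inner x (oproj V y).
Proof.
have e z t : inner (oproj V z) t = inner (oproj V z) (oproj V t).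
  have := oproj_orth t (oproj_mem V z); rewrite innerC => /eqP.
  by rewrite conjC_eq0 innerBr subr_eq0 => /eqP.
by rewrite e innerC -e -innerC.
Qed.

Lemma oproj_orthov x : x \in orthov (@inner C A) V -> oproj V x = 0.
Proof.
move/mem_orthov_iff => xV; apply: inner_eq0.
by rewrite oproj_self oproj_id ?oproj_mem // xV // oproj_mem.
Qed.

Lemma adj_oproj : adj (oproj V) = oproj V.
Proof. exact/adj_eq/oproj_self. Qed.

Lemma oproj_idem : (oproj V \o oproj V = oproj V)%VF.
Proof. by apply/lfunP => x; rewrite comp_lfunE oproj_id ?oproj_mem. Qed.

End Projection.

Lemma orthovS A (V W : {vspace ell2 C A}) :
  (V <= W)%VS -> (orthov (@inner C A) W <= orthov (@inner C A) V)%VS.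
Proof.
move=> VW; apply/subvP => x /mem_orthov_iff xW; apply/mem_orthov_iff => y yV.
by apply: xW; apply: (subvP VW).
Qed.

(** Finite dimension enters here: it is what makes taking orthogonal complements
    a bijection between subspaces. *)
Lemma orthovK A (V : {vspace ell2 C A}) :
  orthov (@inner C A) (orthov (@inner C A) V) = V.
Proof.
apply/eqP; rewrite eqEsubv; apply/andP; split; apply/subvP => x xV.
  suff -> : x = oproj V x by exact: oproj_mem.
  apply/eqP; rewrite -subr_eq0; apply/eqP/inner_eq0; rewrite innerBr.
  rewrite [X in _ - X]oproj_orth ?oproj_mem // subr0 innerC.
  by move/mem_orthov_iff: xV => ->; rewrite ?conjC0 ?oproj_compl.
apply/mem_orthov_iff => y /mem_orthov_iff yV.
by rewrite innerC yV ?conjC0.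
Qed.

Lemma orthov_fullv A : orthov (@inner C A) fullv = 0%VS.
Proof. by rewrite -(orthov0 (@inner C A)) orthovK. Qed.

Lemma mem_tensv A B (V : {vspace ell2 C A}) (V' : {vspace ell2 C B}) x y :
  x \in V -> y \in V' -> tensor x y \in tensv V V'.
Proof.
move=> /coord_vbasis -> /coord_vbasis ->.
rewrite tensorrE linear_sum; apply: rpred_sum => i _.
rewrite linearZ; apply: rpredZ; rewrite /= -tensorrE.
rewrite linear_sum; apply: rpred_sum => j _; rewrite linearZ; apply: rpredZ.
apply/memv_span/allpairsP; exists ((vbasis V)`_i, (vbasis V')`_j).
by rewrite !mem_nth // size_tuple.
Qed.

Lemma tensv_ind A B (V : {vspace ell2 C A}) (V' : {vspace ell2 C B})
    (P : ell2 C (A * B)%type -> Prop) :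
  P 0 -> (forall c x y, P x -> P y -> P (c *: x + y)) ->
  {in V & V', forall x y, P (tensor x y)} -> {in tensv V V', forall z, P z}.
Proof.
move=> P0 PZD PT z /(@coord_span _ _ _ (in_tuple _)) ->.
elim/big_ind: _ => //= [x y Px Py|i _]; first by rewrite -[x]scale1r; apply: PZD.
rewrite -[_ *: _]addr0; apply: PZD => //.
have /allpairsP [[x y] [xV yV' /= ->]] := mem_nth 0 (ltn_ord i).
by apply: PT; apply: vbasis_mem.
Qed.

Lemma tensop_oproj_mem A B (V : {vspace ell2 C A}) (V' : {vspace ell2 C B}) x :
  tensop (oproj V) (oproj V') x \in tensv V V'.
Proof.
rewrite [x]delta_sum linear_sum; apply: rpred_sum => -[a b] _.
rewrite linearZ; apply: rpredZ; rewrite /= -tensor_delta tensopE.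
by rewrite mem_tensv ?oproj_mem.
Qed.

Section Domination.
Variables (A B D : finType) (W : 'Hom(ell2 C A, ell2 C D)) (X : {vspace ell2 C D}).
Hypothesis coW : coisometric W.
Let WK x : W (adj W x) = x.
Proof. by rewrite -comp_lfunE coW id_lfunE. Qed.

Lemma proj_pythagoras (q : 'End(ell2 C A)) x : adj q = q -> (q \o q = q)%VF ->
  inner (x - q x) (x - q x) = inner x x - inner (q x) (q x).
Proof.
move=> sq qq; have qK y : q (q y) = q y by rewrite -[q (q y)]comp_lfunE qq.
have qx : inner (q x) x = inner (q x) (q x) by rewrite [RHS]adjP sq qK adjP sq.
have xq : inner x (q x) = inner (q x) (q x) by rewrite innerC qx -innerC.
by rewrite innerBl !innerBr qx xq subrr subr0.
Qed.

(** A domination of projections, [p <= W q W^*], only has to be tested on the range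
    of [p]. There it squeezes [|W^* x|^2 = |x|^2 <= |q W^* x|^2 <= |W^* x|^2], and
    equality in Pythagoras forces [q W^* x = W^* x]. Conversely, if [q] fixes
    [W^* p x], then [<q W^* x, W^* p x> = |p x|^2], and expanding
    [0 <= |q W^* x - W^* p x|^2] yields the inequality. *)
Lemma le_op_conj (q : 'End(ell2 C A)) : adj q = q -> (q \o q = q)%VF ->
  le_op (oproj X) (W \o q \o adj W)%VF <->
  {in X, forall x, q (adj W x) = adj W x}.
Proof.
move=> sq qq; have qK y : q (q y) = q y by rewrite -[q (q y)]comp_lfunE qq.
have qs x y : inner (q x) y = inner x (q y) by rewrite adjP sq.
have nW x y : inner (adj W x) (adj W y) = inner x y by rewrite -adjP WK.
have pK x : oproj X (oproj X x) = oproj X x by rewrite oproj_id // oproj_mem.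
have eq_inner x : inner ((W \o q \o adj W - oproj X)%VF x) x =
    inner (q (adj W x)) (q (adj W x)) - inner (oproj X x) (oproj X x).
  have qq' y : inner (q y) (q y) = inner (q y) y by rewrite [LHS]qs qK qs.
  by rewrite add_lfunE opp_lfunE innerBl !comp_lfunE adjP qq'
    [in RHS]oproj_self pK oproj_self.
split=> [le x xX|fixX x].
  have := le x; rewrite eq_inner oproj_id // => le'.
  apply/eqP; rewrite eq_sym -subr_eq0; apply/eqP/inner_eq0/eqP.
  by rewrite eq_le inner_ge0 andbT proj_pythagoras // nW -oppr_ge0 opprB.
rewrite eq_inner.
set y := q _; set p := oproj X x.
have yp : inner y (adj W p) = inner p p.
  by rewrite qs fixX ?oproj_mem // nW /p oproj_self pK.
have py : inner (adj W p) y = inner p p by rewrite innerC yp -innerC.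
by have := inner_ge0 (y - adj W p); rewrite innerBl !innerBr nW yp py subrr subr0.
Qed.

(** The adjoint form of the previous condition: [W] sends the kernel of [q], which
    consists of the vectors [v - q v], into the orthogonal complement of [X]. *)
Lemma fixes_adj_iff (q : 'End(ell2 C A)) : adj q = q ->
  {in X, forall x, q (adj W x) = adj W x} <->
  (forall v, W (v - q v) \in orthov (@inner C D) X).
Proof.
move=> sq; have qs x y : inner (q x) y = inner x (q y) by rewrite adjP sq.
split=> [fixX v|orthX x xX].
  by apply/mem_orthov_iff => x xX; rewrite adjP innerBl qs fixX // subrr.
apply: inner_extr => v; rewrite -qs.
apply/eqP; rewrite eq_sym -subr_eq0 -innerBl -adjP; apply/eqP.
by have /mem_orthov_iff -> := orthX v.
Qed.

End Domination.

(** For [q] the projection on [V (x) B] or on [A (x) V], the kernel of [q] is spanned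
    by elementary tensors with one factor orthogonal to [V]. The two domination
    axioms of a standard system thereby become the two halves of the definition of
    an ideal for the product [W (x (x) y)], with complements as the ideal. *)
Section TensorDomination.
Variables (A B D : finType) (W : 'Hom(ell2 C (A * B)%type, ell2 C D)).
Variable X : {vspace ell2 C D}.
Hypothesis coW : coisometric W.

Lemma le_op_tensorl (V : {vspace ell2 C A}) :
  le_op (oproj X) (W \o tensop (oproj V) \1 \o adj W)%VF <->
  (forall x y, x \in orthov (@inner C A) V ->
     W (tensor x y) \in orthov (@inner C D) X).
Proof.
have sq : adj (tensop (oproj V) (\1%VF : 'End(ell2 C B))) = tensop (oproj V) \1%VF.
  by rewrite adj_tensop adj_oproj adj_id.
rewrite le_op_conj // ?fixes_adj_iff //; last first.
  by rewrite tensop_comp oproj_idem comp_lfun1l.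
split=> [orthX x y xV|orthX v].
  have := orthX (tensor x y); rewrite tensopE oproj_orthov //.
  by rewrite [tensor 0 _]tensorrE linear0 subr0.
rewrite [v]delta_sum linear_sum -sumrB linear_sum.
apply: rpred_sum => -[a b] _; rewrite linearZ -scalerBr linearZ; apply: rpredZ.
rewrite /= -tensor_delta tensopE id_lfunE !tensorrE -linearB /= -tensorrE.
exact/orthX/oproj_compl.
Qed.

Lemma le_op_tensorr (V : {vspace ell2 C B}) :
  le_op (oproj X) (W \o tensop \1 (oproj V) \o adj W)%VF <->
  (forall x y, y \in orthov (@inner C B) V ->
     W (tensor x y) \in orthov (@inner C D) X).
Proof.
have sq : adj (tensop (\1%VF : 'End(ell2 C A)) (oproj V)) = tensop \1%VF (oproj V).
  by rewrite adj_tensop adj_oproj adj_id.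
rewrite le_op_conj // ?fixes_adj_iff //; last first.
  by rewrite tensop_comp oproj_idem comp_lfun1l.
split=> [orthX x y yV|orthX v].
  by have := orthX (tensor x y); rewrite tensopE oproj_orthov // linear0 subr0.
rewrite [v]delta_sum linear_sum -sumrB linear_sum.
apply: rpred_sum => -[a b] _; rewrite linearZ -scalerBr linearZ; apply: rpredZ.
rewrite /= -tensor_delta tensopE id_lfunE -linearB.
exact/orthX/oproj_compl.
Qed.

(** A compression [oproj X \o W] of a product by an ideal does not see the compression
    of its arguments; associativity of [W] therefore descends to the compressions. *)
Lemma oproj_tensorl (V : {vspace ell2 C A}) :
  (forall x y, x \in orthov (@inner C A) V ->
     W (tensor x y) \in orthov (@inner C D) X) ->
  forall v, oproj X (W (tensop (oproj V) \1%VF v)) = oproj X (W v).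
Proof.
move=> WV v; rewrite -[RHS]comp_lfunE -2![LHS]comp_lfunE; congr (fun_of_lfun _ v).
apply: eq_lfun_delta => -[a b]; rewrite !comp_lfunE -tensor_delta tensopE id_lfunE.
apply/esym/eqP; rewrite -subr_eq0 -!linearB /= !tensorrE -linearB /= -tensorrE.
exact/eqP/oproj_orthov/WV/oproj_compl.
Qed.

Lemma oproj_tensorr (V : {vspace ell2 C B}) :
  (forall x y, y \in orthov (@inner C B) V ->
     W (tensor x y) \in orthov (@inner C D) X) ->
  forall v, oproj X (W (tensop \1%VF (oproj V) v)) = oproj X (W v).
Proof.
move=> WV v; rewrite -[RHS]comp_lfunE -2![LHS]comp_lfunE; congr (fun_of_lfun _ v).
apply: eq_lfun_delta => -[a b]; rewrite !comp_lfunE -tensor_delta tensopE id_lfunE.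
apply/esym/eqP; rewrite -subr_eq0 -!linearB /=.
exact/eqP/oproj_orthov/WV/oproj_compl.
Qed.

(** The adjoint of the compression is [adj W] restricted to [X]: both projections fix
    [adj W x] for [x] in [X], hence so does their product, whose range is
    [tensv V V']. *)
Lemma coisometry_compression (V : {vspace ell2 C A}) (V' : {vspace ell2 C B}) :
  (forall x y, x \in orthov (@inner C A) V ->
     W (tensor x y) \in orthov (@inner C D) X) ->
  (forall x y, y \in orthov (@inner C B) V' ->
     W (tensor x y) \in orthov (@inner C D) X) ->
  coisometry (tensv V V') X (oproj X \o W)%VF.
Proof.
move=> /le_op_tensorl leV /le_op_tensorr leV'.
have fixV x : x \in X -> tensop (oproj V) \1%VF (adj W x) = adj W x.
  by move: leV x; rewrite (le_op_conj X coW) ?adj_tensop ?adj_oproj ?adj_id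
       ?tensop_comp ?oproj_idem ?comp_lfun1l.
have fixV' x : x \in X -> tensop \1%VF (oproj V') (adj W x) = adj W x.
  by move: leV' x; rewrite (le_op_conj X coW) ?adj_tensop ?adj_oproj ?adj_id
       ?tensop_comp ?oproj_idem ?comp_lfun1l.
split; first by apply/subvP => _ /memv_imgP[x _ ->]; rewrite comp_lfunE oproj_mem.
exists (adj W); split=> [|x y _ yX|y yX].
- apply/subvP => _ /memv_imgP[x xX ->].
  rewrite -(fixV x xX) -(fixV' x xX) -[tensop _ _ (tensop _ _ _)]comp_lfunE.
  by rewrite tensop_comp comp_lfun1l comp_lfun1r tensop_oproj_mem.
- by rewrite comp_lfunE oproj_self oproj_id // adjP.
- by rewrite comp_lfunE -[W _]comp_lfunE coW id_lfunE oproj_id.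
Qed.

End TensorDomination.
End HilbertTheory.

(** * Linear extension of functions of monomials and of basis vectors *)
Section MonoidAlgebra.
Variables (K : monomType) (R : comNzRingType).

Lemma malgZAr (c : R) (p q : {malg R[K]}) : p * (c *: q) = c *: (p * q).
Proof.
suff cC : p * c%:MP = c%:MP * p by rewrite -mul_malgC mulrA cC -mulrA mul_malgC.
rewrite mul_malgC malgM_def fgmulgU malgZ_def; apply: eq_bigr => k _.
by rewrite mulm1 mulrC.
Qed.

Variables (V : lmodType R) (f : K -> V).

Definition linext (p : {malg R[K]}) : V := \sum_(k <- msupp p) p@_k *: f k.

Lemma linextEw (d : {fset K}) p :
  (msupp p `<=` d)%fset -> linext p = \sum_(k <- d) p@_k *: f k.
Proof.
move=> le; rewrite [LHS](big_fset_incl _ le) => //= x xd /mcoeff_outdom ->.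
by rewrite scale0r.
Qed.

Lemma linext_linear : linear linext.
Proof.
move=> c p q.
have leZ : (msupp (c *: p + q) `<=` msupp p `|` msupp q)%fset.
  apply: fsubset_trans (msuppD_le _ _) _.
  by apply: fsetUSS => //; exact: msuppZ_le.
rewrite (linextEw leZ) (linextEw (fsubsetUl (msupp p) (msupp q))).
rewrite (linextEw (fsubsetUr (msupp p) (msupp q))) scaler_sumr -big_split.
by apply: eq_bigr => k _; rewrite mcoeffD mcoeffZ scalerDl scalerA.
Qed.

HB.instance Definition _ :=
  GRing.isLinear.Build R {malg R[K]} V _ linext linext_linear.

Lemma linextU k : linext << k >> = f k.
Proof. by rewrite /linext msuppU1 big_seq_fset1 mcoeffUU scale1r. Qed.

Lemma malg_sumE (p : {malg R[K]}) : p = \sum_(k <- msupp p) p@_k *: << k >>.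
Proof.
rewrite {1}[p]monalgE; apply: eq_bigr => k _.
by apply/malgP => k'; rewrite mcoeffZ !mcoeffU mulrnAr mulr1.
Qed.

Lemma malg_ind (P : {malg R[K]} -> Prop) :
  P 0 -> (forall c p q, P p -> P q -> P (c *: p + q)) ->
  (forall k, P << k >>) -> forall p, P p.
Proof.
move=> P0 PZD PU p; rewrite [p]malg_sumE; elim/big_ind: _ => // [x y Px Py|k _].
  by rewrite -[x]scale1r; apply: PZD.
by rewrite -[_ *: _]addr0; apply: PZD.
Qed.

End MonoidAlgebra.

Section BasisExtension.
Variables (C : numClosedFieldType).

Definition lincomb (A : finType) (V : lmodType C) (f : A -> V) (x : ell2 C A) : V :=
  \sum_a x a *: f a.

Lemma lincomb_linear (A : finType) (V : lmodType C) (f : A -> V) : linear (lincomb f).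
Proof.
move=> c x y; rewrite /lincomb scaler_sumr -big_split; apply: eq_bigr => a _.
by rewrite !ffunE scalerDl scalerA.
Qed.

HB.instance Definition _ (A : finType) (V : lmodType C) (f : A -> V) :=
  GRing.isLinear.Build C (ell2 C A) V _ (lincomb f) (lincomb_linear f).

Lemma lincomb_delta (A : finType) (V : lmodType C) (f : A -> V) a :
  lincomb f (delta a) = f a.
Proof.
rewrite /lincomb (bigD1 a) //= ffunE eqxx scale1r big1 ?addr0 // => b /negPf ne.
by rewrite ffunE ne scale0r.
Qed.

Lemma lincomb_tensor (K : monomType) (A B : finType)
    (f : A -> {malg C[K]}) (g : B -> {malg C[K]}) x y :
  lincomb (fun ab => f ab.1 * g ab.2) (tensor x y) = lincomb f x * lincomb g y.
Proof.
rewrite /lincomb mulr_suml.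
under [RHS]eq_bigr do rewrite mulr_sumr.
rewrite pair_bigA; apply: eq_bigr => -[a b] _ /=.
by rewrite ffunE malgZAr -scalerAl scalerA mulrC.
Qed.

End BasisExtension.

(** * Words, normally ordered words and ideals of the free algebra *)
Section Words.
Variables (C : numClosedFieldType) (m n : nat).
Local Notation letter := ('I_m + 'I_n)%type.
Local Notation ncpoly := (ncpoly C m n).

Definition word (w : seq letter) : ncpoly := << FMonom w >>.
Definition zword (a : seq 'I_m) : ncpoly := word (map inl a).
Definition wword (b : seq 'I_n) : ncpoly := word (map inr b).

Lemma word_nil : word [::] = 1.
Proof. by rewrite /word -fmoneE. Qed.

Lemma word_cat v w : word (v ++ w) = word v * word w.
Proof.
rewrite /word malgM_def fgmulUU mulr1.
by rewrite -[FMonom (v ++ w)](fmmulE (FMonom v) (FMonom w)).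
Qed.

Lemma zvarE i : zvar C n i = word [:: inl i].
Proof. by rewrite /zvar fmuE. Qed.

Lemma wvarE j : wvar C m j = word [:: inr j].
Proof. by rewrite /wvar fmuE. Qed.

Lemma zword_cons i a : zword (i :: a) = zvar C n i * zword a.
Proof. by rewrite zvarE -word_cat. Qed.

Lemma wword_cons j b : wword (j :: b) = wvar C m j * wword b.
Proof. by rewrite wvarE -word_cat. Qed.

Lemma zword_cat a a' : zword (a ++ a') = zword a * zword a'.
Proof. by rewrite /zword map_cat word_cat. Qed.

Lemma wword_cat b b' : wword (b ++ b') = wword b * wword b'.
Proof. by rewrite /wword map_cat word_cat. Qed.

Lemma ncpoly_ind (P : ncpoly -> Prop) :
  P 0 -> (forall c p q, P p -> P q -> P (c *: p + q)) ->
  (forall w, P (word w)) -> forall p, P p.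
Proof. by move=> P0 PZD Pw; apply: malg_ind => // -[w]; apply: Pw. Qed.

(** The monomial [z_a w_b] attached to the basis vector [e_a (x) f_b]: all letters [z]
    stand before all letters [w]. *)
Definition normal_word (s : deg) (a : words m n s) : ncpoly :=
  zword a.1 * wword a.2.

Lemma normal_word_cast s t (e : (s.1 = t.1) * (s.2 = t.2)) (a : words m n s) :
  normal_word (cast_words e a) = normal_word a.
Proof. by rewrite /normal_word /zword /wword !val_tcast. Qed.

Definition empty_words : words m n (0, 0)%N := ([tuple], [tuple]).

Lemma words0 (a : words m n (0, 0)%N) : a = empty_words.
Proof. by case: a => a b; rewrite (tuple0 a) (tuple0 b). Qed.

Lemma ell2_words0 (x : ell2 C (words m n (0, 0)%N)) :
  x = x empty_words *: delta empty_words.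
Proof.
apply/ffunP => a; rewrite !ffunE [in LHS](words0 a) [in RHS](words0 a).
by rewrite (eqxx empty_words) [RHS]mulr1.
Qed.

Lemma normal_word0 (a : words m n (0, 0)%N) : normal_word a = 1.
Proof. by rewrite (words0 a) /normal_word /zword /wword word_nil mulr1. Qed.

(** The inclusion of [E^(x)i (x) F^(x)j] into the free algebra as the span of the
    normally ordered words of degree [(i, j)]. *)
Definition embed s : ell2 C (words m n s) -> ncpoly := lincomb (@normal_word s).

Definition wdeg (w : seq letter) : deg :=
  (count (@is_inl _ _) w, count (predC (@is_inl _ _)) w).

Section Ideal.
Variables (I : set ncpoly).
Hypothesis idI : two_sided_ideal I.

Lemma ideal0 : I 0. Proof. by case: idI. Qed.
Lemma idealD p q : I p -> I q -> I (p + q). Proof. by case: idI => _ + _; apply. Qed.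
Lemma ideal_mull p q : I p -> I (q * p).
Proof. by case: idI => _ _ h Ip; exact: (h p q Ip).1. Qed.
Lemma ideal_mulr p q : I p -> I (p * q).
Proof. by case: idI => _ _ h Ip; exact: (h p q Ip).2. Qed.
Lemma idealZ c p : I p -> I (c *: p).
Proof. by rewrite -mul_malgC; exact: ideal_mull. Qed.
Lemma idealN p : I p -> I (- p).
Proof. by rewrite -scaleN1r; exact: idealZ. Qed.
Lemma ideal_sum T (r : seq T) (P : pred T) F :
  (forall i, P i -> I (F i)) -> I (\sum_(i <- r | P i) F i).
Proof. by move=> IF; elim/big_ind: _ => //; [exact: ideal0|exact: idealD]. Qed.

(** Congruence modulo [I] is written [I (p - q)]. *)
Lemma congr_trans q p r : I (p - q) -> I (q - r) -> I (p - r).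
Proof. by move=> pq qr; rewrite -[p](subrK q) -addrA; exact: idealD. Qed.
Lemma congr_sym p q : I (p - q) -> I (q - p).
Proof. by move/idealN; rewrite opprB. Qed.
Lemma congrM p p' q q' : I (p - p') -> I (q - q') -> I (p * q - p' * q').
Proof.
move=> pp qq; rewrite -[p * q](subrK (p' * q)) -mulrBl -addrA -mulrBr.
exact: (idealD (ideal_mulr _ pp) (ideal_mull _ qq)).
Qed.
Lemma congr_comb c p p' q q' :
  I (p - p') -> I (q - q') -> I ((c *: p + q) - (c *: p' + q')).
Proof.
move=> pp qq; rewrite opprD addrACA -scalerBr.
exact/idealD/qq/idealZ.
Qed.
Lemma congr_ideal p q : I (p - q) -> I p <-> I q.
Proof.
move=> pq; split=> [Ip|Iq]; last by rewrite -[p](subrK q); exact: idealD.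
by rewrite -[q](subrK p); apply: idealD => //; exact: congr_sym.
Qed.

End Ideal.
End Words.

Arguments empty_words {m n}.

(** * The operators Wop implement multiplication modulo the commutation relations *)

Lemma mulr_middle (R : pzRingType) (a b c d : R) :
  (a * b) * (c * d) = a * ((b * c) * d).
Proof. by rewrite !mulrA. Qed.

Section Intertwining.
Implicit Types A B D : finType.
Variables (C : numClosedFieldType) (m n : nat).
Variable u : 'Hom(ell2 C ('I_n * 'I_m)%type, ell2 C ('I_m * 'I_n)%type).
Local Notation ncpoly := (ncpoly C m n).
Local Notation z := (@zvar C m n).
Local Notation w := (@wvar C m n).
Local Notation zword := (@zword C m n).
Local Notation wword := (@wword C m n).

Variable I : set ncpoly.
Hypothesis idI : two_sided_ideal I.

(** [T] intertwines two families of polynomials indexed by bases when it becomes the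
    identity in the quotient of the free algebra by [I]. This property passes through
    composition, relabelling and tensor products, the building blocks of [comm1],
    [comm] and [Wop], so that only [u] itself has to be examined. *)
Definition intertwines (A B : finType) (T : 'Hom(ell2 C A, ell2 C B))
    (f : A -> ncpoly) (g : B -> ncpoly) : Prop :=
  forall x, I (lincomb g (T x) - lincomb f x).

Lemma intertwines_delta A B (T : 'Hom(ell2 C A, ell2 C B)) f g :
  (forall a, I (lincomb g (T (delta a)) - f a)) -> intertwines T f g.
Proof.
move=> IT x; rewrite /lincomb -/(lincomb g (T x)) {1}[x]delta_sum.
rewrite [T _]linear_sum [lincomb g _]linear_sum -sumrB; apply: ideal_sum => // a _.
by rewrite !linearZ /= -scalerDr; apply: idealZ.
Qed.

Lemma intertwines_comp A B D (T : 'Hom(ell2 C A, ell2 C B))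
    (S : 'Hom(ell2 C B, ell2 C D)) f g h :
  intertwines S g h -> intertwines T f g -> intertwines (S \o T)%VF f h.
Proof. by move=> IS IT x; rewrite comp_lfunE; apply: (congr_trans idI (IS _) (IT _)). Qed.

Lemma intertwines_relabel A B (h : A -> B) f g :
  (forall a, g (h a) = f a) -> intertwines (relabel h) f g.
Proof.
move=> e; apply: intertwines_delta => a.
by rewrite relabel_delta lincomb_delta e subrr; apply: ideal0.
Qed.

Lemma intertwines_id A (f : A -> ncpoly) : intertwines \1%VF f f.
Proof. by move=> x; rewrite id_lfunE subrr; apply: ideal0. Qed.

Lemma intertwines_tensop (A A' B B' : finType) (S : 'Hom(ell2 C A, ell2 C B))
    (T : 'Hom(ell2 C A', ell2 C B')) f f' g g' :
  intertwines S f g -> intertwines T f' g' ->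
  intertwines (tensop S T) (fun a => f a.1 * f' a.2) (fun b => g b.1 * g' b.2).
Proof.
move=> IS IT; apply: intertwines_delta => -[a a'].
rewrite -tensor_delta tensopE lincomb_tensor; apply: congrM => //.
  by have := IS (delta a); rewrite lincomb_delta.
by have := IT (delta a'); rewrite lincomb_delta.
Qed.

Hypothesis Iu : forall i j, I (commutation_poly u i j).

(** The polynomials [w_j z_i - u (w_j z_i)] say precisely that [u] becomes the identity
    in the quotient. *)
Lemma intertwines_u :
  intertwines u (fun x => w x.1 * z x.2) (fun y => z y.1 * w y.2).
Proof.
apply: intertwines_delta => -[j i]; rewrite -opprB; apply: idealN => //.
suff <- : commutation_poly u i j = w j * z i -
    lincomb (fun y => z y.1 * w y.2) (u (delta (j, i))) by exact: Iu.
by congr (_ - _); rewrite pair_bigA; apply: eq_bigr => -[k l].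
Qed.

Lemma intertwines_comm1 k :
  intertwines (comm1 u k) (fun x => w x.1 * zword x.2) (fun y => zword y.1 * w y.2).
Proof.
elim: k => [|k IHk].
  apply: intertwines_relabel => -[j a]; rewrite (tuple0 a) /zword /=.
  by rewrite word_nil mul1r mulr1.
(* The intermediate families only move parentheses in a word, except for the two
   genuine steps: [w z -> z w] by [u], and then the induction hypothesis. *)
rewrite /=; apply: (@intertwines_comp _ _ _ _ _ _ (fun x : ('I_n * 'I_m) * k.-tuple 'I_m =>
  w x.1.1 * z x.1.2 * zword x.2)).
  apply: (@intertwines_comp _ _ _ _ _ _ (fun x : ('I_m * 'I_n) * k.-tuple 'I_m =>
    z x.1.1 * w x.1.2 * zword x.2)).
    apply: (@intertwines_comp _ _ _ _ _ _ (fun x : 'I_m * ('I_n * k.-tuple 'I_m) =>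
      z x.1 * (w x.2.1 * zword x.2.2))).
      apply: (@intertwines_comp _ _ _ _ _ _ (fun x : 'I_m * (k.-tuple 'I_m * 'I_n) =>
        z x.1 * (zword x.2.1 * w x.2.2))).
        by apply: intertwines_relabel => -[i [a j]]; rewrite zword_cons mulrA.
      exact: (intertwines_tensop (intertwines_id z) IHk).
    by apply: intertwines_relabel => -[[i j] a]; rewrite mulrA.
  exact: (intertwines_tensop intertwines_u
    (intertwines_id (fun a : k.-tuple _ => zword a))).
apply: intertwines_relabel => -[j a].
by rewrite [in RHS](tuple_eta a) zword_cons mulrA.
Qed.

Lemma intertwines_comm j k :
  intertwines (comm u j k) (fun x => wword x.1 * zword x.2)
    (fun y => zword y.1 * wword y.2).
Proof.
elim: j => [|j IHj].
  apply: intertwines_relabel => -[b a]; rewrite (tuple0 b) /wword /=.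
  by rewrite word_nil mul1r mulr1.
rewrite /=; apply: (@intertwines_comp _ _ _ _ _ _ (fun x :
    'I_n * (j.-tuple 'I_n * k.-tuple 'I_m) => w x.1 * (wword x.2.1 * zword x.2.2))).
  apply: (@intertwines_comp _ _ _ _ _ _ (fun x : 'I_n * (k.-tuple 'I_m * j.-tuple 'I_n) =>
    w x.1 * (zword x.2.1 * wword x.2.2))).
    apply: (@intertwines_comp _ _ _ _ _ _ (fun x : ('I_n * k.-tuple 'I_m) * j.-tuple 'I_n =>
      (w x.1.1 * zword x.1.2) * wword x.2)).
      apply: (@intertwines_comp _ _ _ _ _ _ (fun x :
          (k.-tuple 'I_m * 'I_n) * j.-tuple 'I_n => (zword x.1.1 * w x.1.2) * wword x.2)).
        by apply: intertwines_relabel => -[[a l] b]; rewrite wword_cons mulrA.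
      exact: (intertwines_tensop (@intertwines_comm1 k)
               (intertwines_id (fun b : j.-tuple _ => wword b))).
    by apply: intertwines_relabel => -[l [a b]]; rewrite mulrA.
  exact: (intertwines_tensop (intertwines_id w) IHj).
apply: intertwines_relabel => -[b a].
by rewrite [in RHS](tuple_eta b) wword_cons mulrA.
Qed.

Lemma intertwines_Wop s t :
  intertwines (Wop u s t) (fun x => normal_word C x.1 * normal_word C x.2)
    (@normal_word C m n (addd s t)).
Proof.
pose f (x : (s.1).-tuple 'I_m *
    (((s.2).-tuple 'I_n * (t.1).-tuple 'I_m) * (t.2).-tuple 'I_n)) :=
  zword x.1 * ((wword x.2.1.1 * zword x.2.1.2) * wword x.2.2).
pose g (x : (s.1).-tuple 'I_m *
    (((t.1).-tuple 'I_m * (s.2).-tuple 'I_n) * (t.2).-tuple 'I_n)) :=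
  zword x.1 * ((zword x.2.1.1 * wword x.2.1.2) * wword x.2.2).
apply: (@intertwines_comp _ _ _ _ _ _ f).
  apply: (@intertwines_comp _ _ _ _ _ _ g).
    apply: intertwines_relabel => -[a [[a' b] b']].
    by rewrite /normal_word /g /= zword_cat wword_cat; exact: mulr_middle.
  exact: (intertwines_tensop (intertwines_id (fun a : (s.1).-tuple _ => zword a))
    (intertwines_tensop (@intertwines_comm _ _)
      (intertwines_id (fun b : (t.2).-tuple _ => wword b)))).
by apply: intertwines_relabel => -[[a b] [a' b']]; apply/esym/mulr_middle.
Qed.

(** Consequently [x, y |-> Wop u s t (tensor x y)] is the multiplication of the
    quotient algebra read on normally ordered representatives. *)
Lemma embed_Wop s t x y :
  I (embed (Wop u s t (tensor x y)) - embed x * embed y).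
Proof. by rewrite -lincomb_tensor; apply: intertwines_Wop. Qed.

End Intertwining.

(** * Coisometry of the operators Wop *)
Section CoisometricW.
Variables (C : numClosedFieldType) (m n : nat).
Variable u : 'Hom(ell2 C ('I_n * 'I_m)%type, ell2 C ('I_m * 'I_n)%type).
Hypothesis cou : coisometric u.

Lemma coisometric_comm1 k : coisometric (comm1 u k).
Proof.
elim: k => [|k IHk].
  by apply: (@coisometric_relabel _ _ _ _ (fun x => (x.2, x.1))) => -[].
apply: coisometric_comp; last first.
  apply: (@coisometric_relabel _ _ _ _ (fun x : ('I_n * 'I_m) * k.-tuple 'I_m =>
    (x.1.1, [tuple of x.1.2 :: x.2]))) => [[j a]|[[j i] a]] /=.
    by rewrite -tuple_eta.
  by rewrite theadE; congr (_, _); apply/val_inj.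
apply: coisometric_comp; last exact/coisometric_tensop/coisometric_id.
apply: coisometric_comp; last first.
  by apply: (@coisometric_relabel _ _ _ _ (fun x => ((x.1, x.2.1), x.2.2)))
    => [[[]]|[? []]].
apply: coisometric_comp; last exact/coisometric_tensop/IHk/coisometric_id.
apply: (@coisometric_relabel _ _ _ _ (fun x : k.+1.-tuple 'I_m * 'I_n =>
    (thead x.1, ([tuple of behead x.1], x.2)))) => [[i [a j]]|[a j]] /=.
  by rewrite theadE; congr (_, (_, _)); apply/val_inj.
by rewrite -tuple_eta.
Qed.

Lemma coisometric_comm j k : coisometric (comm u j k).
Proof.
elim: j => [|j IHj].
  by apply: (@coisometric_relabel _ _ _ _ (fun x => (x.2, x.1))) => -[].
apply: coisometric_comp; last first.
  apply: (@coisometric_relabel _ _ _ _ (fun x : 'I_n * (j.-tuple 'I_n * k.-tuple 'I_m) =>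
    ([tuple of x.1 :: x.2.1], x.2.2))) => [[b a]|[l [b a]]] /=.
    by rewrite -tuple_eta.
  by rewrite theadE; congr (_, (_, _)); apply/val_inj.
apply: coisometric_comp; last exact/coisometric_tensop/IHj/coisometric_id.
apply: coisometric_comp; last first.
  by apply: (@coisometric_relabel _ _ _ _ (fun x => (x.1.1, (x.1.2, x.2))))
    => [[? []]|[[]]].
apply: coisometric_comp; last first.
  exact/coisometric_tensop/coisometric_id/coisometric_comm1.
apply: (@coisometric_relabel _ _ _ _ (fun x : k.-tuple 'I_m * j.+1.-tuple 'I_n =>
    ((x.1, thead x.2), [tuple of behead x.2]))) => [[[a l] b]|[a b]] /=.
  by rewrite theadE; congr (_, _); apply/val_inj.
by rewrite -tuple_eta.
Qed.

Lemma size_take_tuple (T : Type) p q (a : (p + q).-tuple T) : size (take p a) == p.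
Proof. by rewrite size_takel // size_tuple leq_addr. Qed.
Lemma size_drop_tuple (T : Type) p q (a : (p + q).-tuple T) : size (drop p a) == q.
Proof. by rewrite size_drop size_tuple addKn. Qed.

Lemma coisometric_Wop s t : coisometric (Wop u s t).
Proof.
apply: coisometric_comp; last first.
  by apply: (@coisometric_relabel _ _ _ _ (fun x => ((x.1, x.2.1.1), (x.2.1.2, x.2.2))))
    => [[[? ?] []]|[? [[]]]].
apply: coisometric_comp; last first.
  apply: coisometric_tensop; first exact: coisometric_id.
  by apply: coisometric_tensop; [exact: coisometric_comm|exact: coisometric_id].
apply: (@coisometric_relabel _ _ _ _ (fun x : words m n (addd s t) =>
  (Tuple (size_take_tuple x.1),
    ((Tuple (size_drop_tuple x.1), Tuple (size_take_tuple x.2)),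
      Tuple (size_drop_tuple x.2))))) => [[a [[a' b] b']]|[a b]] /=.
  by congr (_, ((_, _), _)); apply/val_inj => /=;
    rewrite ?take_size_cat ?drop_size_cat ?size_tuple.
by congr (_, _); apply/val_inj; rewrite /= cat_take_drop.
Qed.

End CoisometricW.

(** * Normal ordering *)

Lemma linear_combACA (R : comPzRingType) (V : lmodType R) (c d : R) (x x' y y' : V) :
  d *: (c *: x + x') + (c *: y + y') = c *: (d *: x + y) + (d *: x' + y').
Proof. by rewrite !scalerDr !scalerA [d * c]mulrC addrACA. Qed.

Section NormalOrdering.
Variables (C : numClosedFieldType) (m n : nat).
Variable u : 'Hom(ell2 C ('I_n * 'I_m)%type, ell2 C ('I_m * 'I_n)%type).
Local Notation letter := ('I_m + 'I_n)%type.
Local Notation ncpoly := (ncpoly C m n).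
Local Notation z := (@zvar C m n).
Local Notation w := (@wvar C m n).
Local Notation word := (@word C m n).

(** The relations allow every polynomial to be rewritten in normally ordered form. To
    see that this form is unique, let the free algebra act on itself: [z_i] acts by left
    multiplication, and [w_j] travels to the right through the leading letters [z],
    being exchanged with each of them by [u], until it meets a letter [w] or the end of
    the word. The relations act as zero by construction, whereas acting with a normally
    ordered word on [1] returns that word. *)
Fixpoint w_on_word (j : 'I_n) (v : seq letter) : ncpoly :=
  match v with
  | inl i :: v' =>
      \sum_(k < m) \sum_(l < n) u (delta (j, i)) (k, l) *: (z k * w_on_word l v')
  | _ => word (inr j :: v)
  end.

Definition wact (j : 'I_n) : ncpoly -> ncpoly :=
  linext (fun v : {fmonom letter} => w_on_word j v).
HB.instance Definition _ j := GRing.Linear.on (wact j).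

Lemma wact_word j v : wact j (word v) = w_on_word j v.
Proof. by rewrite /wact linextU. Qed.

Lemma wactP j c p q : wact j (c *: p + q) = c *: wact j p + wact j q.
Proof. by rewrite linearP. Qed.

(** The exchange rule holds on all of the free algebra and not just on normally
    ordered elements; this is why the relations annihilate everything. *)
Lemma wact_z j i p : wact j (z i * p) =
  \sum_(k < m) \sum_(l < n) u (delta (j, i)) (k, l) *: (z k * wact l p).
Proof.
elim/ncpoly_ind: p => [|c p q IHp IHq|v].
- rewrite mulr0 linear0 big1 // => k _; rewrite big1 // => l _.
  by rewrite linear0 mulr0 scaler0.
- rewrite mulrDr malgZAr wactP; apply: (etrans (congr2 (fun x y => c *: x + y) IHp IHq)).
  rewrite scaler_sumr -big_split.
  apply: eq_bigr => k _; rewrite scaler_sumr -big_split; apply: eq_bigr => l _.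
  by rewrite wactP mulrDr malgZAr [in RHS]scalerDr !scalerA [c * _]mulrC.
- rewrite zvarE -word_cat wact_word; apply: eq_bigr => k _.
  by apply: eq_bigr => l _; rewrite wact_word.
Qed.

Definition letter_act (x : letter) : ncpoly -> ncpoly :=
  match x with inl i => fun p => z i * p | inr j => wact j end.

Definition word_act (v : seq letter) (p : ncpoly) : ncpoly := foldr letter_act p v.

Lemma word_act_linear v : linear (word_act v).
Proof.
move=> c p q; elim: v => //= -[i|j] v -> /=; last by rewrite linearP.
by rewrite mulrDr malgZAr.
Qed.
HB.instance Definition _ v :=
  GRing.isLinear.Build C ncpoly ncpoly _ (word_act v) (word_act_linear v).

Definition actr (v : ncpoly) : ncpoly -> ncpoly :=
  linext (fun x : {fmonom letter} => word_act x v).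
HB.instance Definition _ v := GRing.Linear.on (actr v).

Definition act (p v : ncpoly) : ncpoly := actr v p.

Lemma actrE p v : act p v = actr v p. Proof. by []. Qed.

Lemma actPl c p q v : act (c *: p + q) v = c *: act p v + act q v.
Proof. by rewrite /act linearP. Qed.

Lemma act0l v : act 0 v = 0. Proof. by rewrite /act linear0. Qed.

Lemma act_word x v : act (word x) v = word_act x v.
Proof. by rewrite /act /actr linextU. Qed.

Lemma act_linear p : linear (act p).
Proof.
move=> c v v'; elim/ncpoly_ind: p => [|d p q IHp IHq|x].
- by rewrite !act0l scaler0 addr0.
- by rewrite !actPl IHp IHq; exact: linear_combACA.
- by rewrite !act_word linearP.
Qed.
HB.instance Definition _ p :=
  GRing.isLinear.Build C ncpoly ncpoly _ (act p) (act_linear p).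

Lemma actM p q v : act (p * q) v = act p (act q v).
Proof.
elim/ncpoly_ind: p => [|c p p' IHp IHp'|x].
- by rewrite mul0r !act0l.
- by rewrite mulrDl -scalerAl !actPl; exact: (congr2 (fun x y => c *: x + y) IHp IHp').
elim/ncpoly_ind: q => [|c q q' IHq IHq'|y].
- by rewrite mulr0 act0l linear0.
- rewrite mulrDr malgZAr !actPl [RHS]linearP.
  exact: (congr2 (fun x y => c *: x + y) IHq IHq').
- by rewrite -word_cat !act_word /word_act foldr_cat.
Qed.

(** The kernel of the representation: an ideal that contains the commutation
    polynomials and modulo which distinct normally ordered elements stay distinct. *)
Definition annihilator : set ncpoly := fun p => forall v, act p v = 0.

Lemma annihilator_ideal : two_sided_ideal annihilator.
Proof.
split=> [v|p q Kp Kq v|p q Kp]; first by rewrite actrE linear0.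
  by rewrite actrE linearD /= -!actrE Kp Kq addr0.
by split=> v; rewrite actM Kp // linear0.
Qed.

Lemma act_zw i j v : act (z i * w j) v = z i * wact j v.
Proof. by rewrite actM zvarE wvarE !act_word /= -zvarE. Qed.

Lemma act_wz i j v : act (w j * z i) v = wact j (z i * v).
Proof. by rewrite actM zvarE wvarE !act_word /= -zvarE. Qed.

Lemma annihilator_comm i j : annihilator (commutation_poly u i j).
Proof.
move=> v; rewrite /act /commutation_poly linearB; apply/eqP; rewrite subr_eq0; apply/eqP.
apply: etrans (act_wz i j v) _; rewrite wact_z linear_sum.
apply: eq_bigr => k _; rewrite linear_sum; apply: eq_bigr => l _.
by rewrite linearZ; congr (_ *: _); rewrite -act_zw.
Qed.

Definition normal_form (p : ncpoly) : ncpoly := act p 1.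

Lemma normal_form_congr p q : annihilator (p - q) -> normal_form p = normal_form q.
Proof.
move=> /(_ 1); rewrite actrE linearB /= -!actrE => /eqP.
by rewrite subr_eq0 => /eqP.
Qed.

Lemma word_act_inr (b : seq 'I_n) : word_act (map inr b) 1 = word (map inr b).
Proof.
elim: b => [|j b IHb] /=; first by rewrite word_nil.
rewrite IHb wact_word; by case: b {IHb}.
Qed.

Lemma normal_form_normal_word s (a : words m n s) :
  normal_form (normal_word C a) = normal_word C a.
Proof.
rewrite /normal_form /normal_word actM /zword /wword !act_word word_act_inr.
elim: (tval a.1) => [|i x IHx] /=; first by rewrite word_nil mul1r.
apply: etrans (congr1 (fun p => z i * p) IHx) _.
apply: etrans (mulrA _ _ _) (congr1 (fun p => p * word _) _).
by rewrite zvarE -word_cat.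
Qed.

Lemma normal_form_embed s (x : ell2 C (words m n s)) :
  normal_form (embed x) = embed x.
Proof.
rewrite /normal_form /embed /lincomb actrE linear_sum; apply: eq_bigr => a _.
by rewrite linearZ /= -actrE -[act _ _]/(normal_form _) normal_form_normal_word.
Qed.

Definition normal_monom s (a : words m n s) : {fmonom letter} :=
  FMonom (map inl a.1 ++ map inr a.2).

Lemma normal_wordE s (a : words m n s) : normal_word C a = << normal_monom a >>.
Proof. by rewrite /normal_word -word_cat. Qed.

Lemma wdeg_normal s (a : words m n s) : wdeg (normal_monom a) = s.
Proof.
rewrite /wdeg /= !count_cat !count_map; case: s a => i j -[a b] /=.
by rewrite !count_predT !count_pred0 !size_tuple addn0.
Qed.

Lemma normal_monom_inj s : injective (@normal_monom s).
Proof.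
move=> [a b] [a' b'] [] /eqP; rewrite eqseq_cat ?size_map ?size_tuple //.
case/andP=> /eqP ea /eqP eb; congr (_, _); apply: val_inj.
  by apply: inj_map ea => ? ? [].
by apply: inj_map eb => ? ? [].
Qed.

(** The component of degree [s] of the normal form, as a vector of
    [E^(x)i (x) F^(x)j]. *)
Definition coord_form s (p : ncpoly) : ell2 C (words m n s) :=
  [ffun a => (normal_form p)@_(normal_monom a)].

Lemma coord_form_linear s : linear (coord_form s).
Proof.
move=> c p q; apply/ffunP => a; rewrite [LHS]ffunE [RHS]ffunE.
rewrite [X in _ = X + _]ffunE [X in _ = _ *: X + _]ffunE [X in _ = _ + X]ffunE.
rewrite /normal_form actPl.
by rewrite mcoeffD mcoeffZ.
Qed.
HB.instance Definition _ s :=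
  GRing.isLinear.Build C ncpoly (ell2 C (words m n s)) _
    (coord_form s) (coord_form_linear s).

Lemma coord_form_congr s p q : annihilator (p - q) -> coord_form s p = coord_form s q.
Proof.
by move=> pq; apply/ffunP => a; rewrite [LHS]ffunE [RHS]ffunE (normal_form_congr pq).
Qed.

Lemma mcoeff_embed s t (x : ell2 C (words m n s)) (a : words m n t) :
  (embed x)@_(normal_monom a) = \sum_b x b * (normal_monom b == normal_monom a)%:R.
Proof.
rewrite /embed /lincomb raddf_sum; apply: eq_bigr => b _.
by rewrite /= mcoeffZ normal_wordE mcoeffU1.
Qed.

Lemma coord_formK s (x : ell2 C (words m n s)) : coord_form s (embed x) = x.
Proof.
apply/ffunP => a; rewrite ffunE normal_form_embed mcoeff_embed.
rewrite (bigD1 a) //= eqxx mulr1 big1 ?addr0 // => b /negPf ne.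
by rewrite (inj_eq (@normal_monom_inj s)) ne mulr0.
Qed.

Lemma coord_form_neq s t (x : ell2 C (words m n s)) :
  s != t -> coord_form t (embed x) = 0.
Proof.
move=> st; apply/ffunP => a; rewrite !ffunE normal_form_embed mcoeff_embed.
rewrite big1 // => b _; case: eqP => [e|_]; last by rewrite mulr0.
by case/negP: st; rewrite -(wdeg_normal b) e wdeg_normal.
Qed.

(** Uniqueness of normal forms. Identities between operators on the spaces
    [ell2 C (words m n s)] can therefore be checked in the free algebra, modulo the
    annihilator. *)
Lemma embed_congr_inj s (x y : ell2 C (words m n s)) :
  annihilator (embed x - embed y) -> x = y.
Proof.
move=> e; rewrite -(coord_formK x) -(coord_formK y).
exact: coord_form_congr e.
Qed.

End NormalOrdering.

(** * Homogeneous components and graded ideals *)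
Section HomogeneousComponents.
Variables (C : numClosedFieldType) (m n : nat).
Local Notation letter := ('I_m + 'I_n)%type.
Local Notation ncpoly := (ncpoly C m n).

Definition hcomp (s : deg) : ncpoly -> ncpoly :=
  linext (fun v : {fmonom letter} => if wdeg v == s then << v >> else 0 : ncpoly).
HB.instance Definition _ s := GRing.Linear.on (hcomp s).

Lemma hcomp_word s v : hcomp s (word C v) = if wdeg v == s then word C v else 0.
Proof. by rewrite /hcomp linextU. Qed.

Definition degrees (p : ncpoly) : seq deg :=
  undup [seq wdeg v | v : {fmonom letter} <- msupp p].

Lemma hcomp_sum p : p = \sum_(s <- degrees p) hcomp s p.
Proof.
rewrite exchange_big {1}[p]malg_sumE big_seq [RHS]big_seq; apply: eq_bigr => v vp.
rewrite -scaler_sumr; congr (_ *: _).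
rewrite (bigD1_seq (wdeg v)); last exact: undup_uniq.
  rewrite eqxx big1 => [|s]; first by rewrite /= addr0.
  by rewrite eq_sym => /negPf ->.
by rewrite mem_undup; exact: (map_f (fun v : {fmonom letter} => wdeg v)).
Qed.

Lemma hcomp_homogeneous s p : homogeneous (hcomp s p) s.1 s.2.
Proof.
move=> v; rewrite -mcoeff_neq0 => nz.
suff /eqP <- : wdeg v == s by [].
apply: contraNT nz => vs; rewrite raddf_sum big1 // => k _.
rewrite /= mcoeffZ; case: ifP => [ks|_]; last by rewrite mcoeff0 mulr0.
rewrite mcoeffU1; case: eqP => [kv|_]; last by rewrite mulr0.
by rewrite -kv ks in vs.
Qed.

Lemma hcomp_id p i j : homogeneous p i j -> hcomp (i, j) p = p.
Proof.
move=> hp; rewrite [RHS]malg_sumE /hcomp /linext [LHS]big_seq [RHS]big_seq.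
by apply: eq_bigr => v /hp [vi vj]; rewrite /wdeg vi vj eqxx.
Qed.

End HomogeneousComponents.

Section GradedIdeals.
Variables (C : numClosedFieldType) (m n : nat).
Variable u : 'Hom(ell2 C ('I_n * 'I_m)%type, ell2 C ('I_m * 'I_n)%type).
Local Notation letter := ('I_m + 'I_n)%type.
Local Notation ncpoly := (ncpoly C m n).

Definition relation_ideal (I : set ncpoly) : Prop :=
  two_sided_ideal I /\ forall i j, I (commutation_poly u i j).

Lemma relation_ideal_annihilator : relation_ideal (@annihilator C m n u).
Proof. by split; [exact: annihilator_ideal|exact: annihilator_comm]. Qed.

(** Existence of normal forms. The representative [x] is built letter by letter with
    [Wop], and it does not depend on the ideal; taking the annihilator for [I]
    identifies it with [coord_form]. *)
Lemma word_congr_embed (v : seq letter) :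
  exists x : ell2 C (words m n (wdeg v)),
    forall I, relation_ideal I -> I (word C v - embed x).
Proof.
elim: v => [|[i|j] v [x IHx]].
- exists (delta empty_words) => I [idI _].
  by rewrite /embed lincomb_delta normal_word0 word_nil subrr; exact: ideal0.
- pose e : ell2 C (words m n (1, 0)%N) := delta ([tuple i], [tuple]).
  exists (Wop u (1, 0)%N (wdeg v) (tensor e x)) => I II.
  have [idI Iu] := II.
  apply: (congr_trans idI (q := embed e * embed x)); last first.
    exact: (congr_sym idI (embed_Wop idI Iu e x)).
  rewrite -cat1s word_cat; apply: congrM => //; last exact: IHx.
  rewrite /embed lincomb_delta /normal_word /zword /wword.
  rewrite [word C (map inr _)]word_nil mulr1 subrr.
  exact: ideal0.
- pose e : ell2 C (words m n (0, 1)%N) := delta ([tuple], [tuple j]).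
  exists (Wop u (0, 1)%N (wdeg v) (tensor e x)) => I II.
  have [idI Iu] := II.
  apply: (congr_trans idI (q := embed e * embed x)); last first.
    exact: (congr_sym idI (embed_Wop idI Iu e x)).
  rewrite -cat1s word_cat; apply: congrM => //; last exact: IHx.
  rewrite /embed lincomb_delta /normal_word /zword /wword.
  rewrite [word C (map inl _)]word_nil mul1r subrr.
  exact: ideal0.
Qed.

(** Normal ordering is homogeneous: exchanging letters preserves the degree of a word,
    so the component of degree [s] of [p] is congruent to that of its normal form. *)
Lemma hcomp_congr_embed I s p :
  relation_ideal I -> I (hcomp s p - embed (coord_form u s p)).
Proof.
move=> II; have [idI _] := II.
elim/ncpoly_ind: p => [|c p q IHp IHq|v].
- by rewrite linear0 linear0 /embed linear0 subrr; exact: ideal0.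
- have -> : hcomp s (c *: p + q) = c *: hcomp s p + hcomp s q by rewrite linearP.
  have -> : embed (coord_form u s (c *: p + q)) =
      c *: embed (coord_form u s p) + embed (coord_form u s q).
    by rewrite linearP /embed linearP.
  exact: (congr_comb idI c IHp IHq).
have [x xP] := word_congr_embed v.
have cE t : coord_form u t (word C v) = coord_form u t (embed x).
  exact: (coord_form_congr t (xP _ relation_ideal_annihilator)).
rewrite hcomp_word; case: eqP => [e|ne].
  by case: s / e; rewrite cE coord_formK; exact: (xP I II).
rewrite cE coord_form_neq; last exact/eqP.
by rewrite /embed linear0 subrr; exact: ideal0.
Qed.

Lemma ideal_embed_coord I p : relation_ideal I ->
  (forall s, I (embed (coord_form u s p))) -> I p.
Proof.
move=> II Ip; have [idI _] := II; rewrite [p]hcomp_sum.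
apply: (ideal_sum idI) => s _.
by apply/(congr_ideal idI (hcomp_congr_embed s p II)).
Qed.

(** A two-sided ideal, given by its homogeneous components, of the quotient of the
    free algebra by the commutation polynomials. *)
Definition graded_ideal (V : subspace_family C m n) : Prop := forall s t x y,
  (x \in V s -> Wop u s t (tensor x y) \in V (addd s t)) /\
  (y \in V t -> Wop u s t (tensor x y) \in V (addd s t)).

(** The preimage of a graded subspace of the quotient algebra. *)
Definition pullback (V : subspace_family C m n) : set ncpoly :=
  fun p => forall s, coord_form u s p \in V s.

Section Pullback.
Variable V : subspace_family C m n.
Let K := @annihilator C m n u.

Lemma pullback_lin c p q : pullback V p -> pullback V q -> pullback V (c *: p + q).
Proof.
by move=> Vp Vq s; rewrite linearP; apply: memvD; [apply: memvZ; exact: Vp|exact: Vq].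
Qed.

Lemma pullbackD p q : pullback V p -> pullback V q -> pullback V (p + q).
Proof. by move=> Vp Vq; have := pullback_lin 1 Vp Vq; rewrite scale1r. Qed.

Lemma pullback0 : pullback V 0.
Proof. by move=> s; rewrite linear0 mem0v. Qed.

Lemma pullback_congr p q : K (p - q) -> pullback V q -> pullback V p.
Proof. by move=> pq Vq s; rewrite (coord_form_congr s pq). Qed.

Lemma pullback_embed s x : pullback V (@embed C m n s x) <-> x \in V s.
Proof.
split=> [/(_ s)|xV t]; first by rewrite coord_formK.
have [e|st] := eqVneq s t; first by case: t / e; rewrite coord_formK.
by rewrite coord_form_neq // mem0v.
Qed.

Lemma pullback_sum T (r : seq T) (F : T -> ncpoly) :
  (forall i, pullback V (F i)) -> pullback V (\sum_(i <- r) F i).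
Proof.
by move=> VF; elim/big_ind: _ => [|p q Vp Vq|i _];
  [exact: pullback0|exact: pullbackD|exact: VF].
Qed.

Lemma pullback_hcomp s p : pullback V p -> pullback V (hcomp s p).
Proof.
move=> Vp; apply: (pullback_congr (hcomp_congr_embed s p relation_ideal_annihilator)).
exact/pullback_embed.
Qed.

Hypothesis gV : graded_ideal V.

(** It is enough to multiply homogeneous components, where the product is
    computed by [Wop]. *)
Lemma pullback_ideal : two_sided_ideal (pullback V).
Proof.
have idK := annihilator_ideal u.
have mulcomp p q s t : coord_form u s p \in V s \/ coord_form u t q \in V t ->
    pullback V (hcomp s p * hcomp t q).
  move=> Vpq.
  pose x := coord_form u s p; pose y := coord_form u t q.
  have K1 : K (hcomp s p * hcomp t q - embed x * embed y).
    by apply: (congrM idK); exact: (hcomp_congr_embed _ _ relation_ideal_annihilator).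
  have K2 : K (embed x * embed y - embed (Wop u s t (tensor x y))).
    exact: (congr_sym idK (embed_Wop idK (@annihilator_comm _ _ _ u) x y)).
  apply: (pullback_congr (congr_trans idK K1 K2)); apply/pullback_embed.
  by have [hl hr] := gV x y; case: Vpq; [exact: hl|exact: hr].
split=> [|p q Vp Vq|p q Vp]; first exact: pullback0.
  exact: pullbackD.
rewrite [p]hcomp_sum [q]hcomp_sum; split.
  rewrite mulr_suml; apply: pullback_sum => s.
  by rewrite mulr_sumr; apply: pullback_sum => t; apply: mulcomp; right.
rewrite mulr_suml; apply: pullback_sum => s.
by rewrite mulr_sumr; apply: pullback_sum => t; apply: mulcomp; left.
Qed.

Lemma pullback_relation_ideal : relation_ideal (pullback V).
Proof.
split=> [|i j]; first exact: pullback_ideal.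
apply: (pullback_congr (q := 0)); last exact: pullback0.
by rewrite subr0; exact: annihilator_comm.
Qed.

(** The generators are the homogeneous elements of the ideal itself. *)
Lemma pullback_homogeneous : homogeneous_ideal (pullback V).
Proof.
exists (fun p => pullback V p /\ exists i j, homogeneous p i j); split=> [p []//|].
rewrite eqEsubset; split=> p.
  move=> Vp J [idJ GJ]; rewrite [p]hcomp_sum; apply: (ideal_sum idJ) => s _.
  apply: GJ; split; first exact: pullback_hcomp.
  by exists s.1, s.2; exact: hcomp_homogeneous.
by apply; split=> [|q []//]; exact: pullback_ideal.
Qed.

(** The degree [(0, 0)] consists of the scalars, so a nonzero element there makes [1] a
    member of the ideal. *)
Lemma pullback_proper : (pullback V <> setT) <-> V (0, 0)%N = 0%VS.
Proof.
split=> [prV|V0].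
  apply/eqP; rewrite -subv0; apply/subvP => x xV; rewrite memv0.
  apply/negPn/negP => x0; apply: prV; apply/seteqP; split=> // p _.
  have xE : embed x = x empty_words *: 1.
    by rewrite [in LHS](ell2_words0 x) /embed linearZ /= lincomb_delta normal_word0.
  have xn0 : x empty_words != 0.
    by apply: contra x0 => /eqP e; rewrite (ell2_words0 x) e scale0r.
  have idV := pullback_ideal; rewrite -[p]mulr1; apply: (ideal_mull idV).
  have -> : 1 = (x empty_words)^-1 *: embed x :> ncpoly.
    by rewrite xE; exact/esym/scalerK.
  exact/(idealZ idV)/pullback_embed.
move=> VT; have : pullback V (embed (delta empty_words : ell2 C (words m n (0, 0)%N))).
  by rewrite VT.
move/pullback_embed; rewrite V0 memv0 => /eqP/ffunP/(_ empty_words).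
by rewrite !ffunE (eqxx empty_words) => /eqP; rewrite oner_eq0.
Qed.

End Pullback.

Lemma pullbackS V V' :
  (pullback V `<=` pullback V')%classic <-> (forall s, (V s <= V' s)%VS).
Proof.
split=> [VV' s|VV' p Vp s]; last exact: subvP (VV' s) _ (Vp s).
by apply/subvP => x /pullback_embed /VV' /pullback_embed.
Qed.

(** A subspace of maximal dimension among those contained in [P] exhausts [P], since it
    could otherwise be enlarged by a line. *)
Lemma subspace_of_pred (T : vectType C) (P : T -> Prop) :
  P 0 -> (forall c x y, P x -> P y -> P (c *: x + y)) ->
  exists V : {vspace T}, forall x, x \in V <-> P x.
Proof.
move=> P0 PZD.
pose dims k := `[< exists2 V : {vspace T}, forall x, x \in V -> P x & \dim V = k >].
have ex0 : exists k, dims k.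
  exists 0%N; apply/asboolP; exists 0%VS; last exact: dimv0.
  by move=> x; rewrite memv0 => /eqP ->.
have le_dims k : dims k -> (k <= dim T)%N.
  by move=> /asboolP[V _ <-]; rewrite -dimvf dimvS ?subvf.
case: (ex_maxnP ex0 le_dims) => _ /asboolP[V VP <-] maxV.
exists V => x; split=> [|Px]; first exact: VP.
have /maxV : dims (\dim (V + <[x]>)%VS).
  apply/asboolP; exists (V + <[x]>)%VS => // y /memv_addP[v vV [_ /vlineP[c ->] ->]].
  by rewrite addrC; apply: PZD => //; exact: VP.
by rewrite (geq_leqif (dimv_leqif_sup (addvSl V <[x]>))) subv_add subvv -memvE.
Qed.

(** The components of the graded ideal are the preimages [{x | I (embed x)}]. An element
    whose components lie in them belongs to [I] because it is congruent to the sum of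
    the latter. For the converse, the pullback is an ideal, so it is enough that it
    contains homogeneous generators of [I], which have a single component. *)
Lemma homogeneous_ideal_pullback I : relation_ideal I -> homogeneous_ideal I ->
  exists2 V, graded_ideal V & I = pullback V.
Proof.
move=> II [G [homG IG]]; have [idI Iu] := II.
have exV : forall s, exists V : {vspace ell2 C (words m n s)},
    forall x, x \in V <-> I (embed x).
  move=> s; apply: subspace_of_pred; first by rewrite /embed linear0; exact: ideal0.
  move=> c x y Ix Iy; rewrite /embed linearP.
  exact: (idealD idI (idealZ idI c Ix) Iy).
pose V s := sval (cid (exV s)).
have VP s x : x \in V s <-> I (embed x) := svalP (cid (exV s)) x.
have gV : graded_ideal V.
  move=> s t x y; have EW := congr_ideal idI (embed_Wop idI Iu x y).
  split=> h; apply: (VP _ _).2; apply: EW.2.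
    exact: (ideal_mulr idI _ ((VP s x).1 h)).
  exact: (ideal_mull idI _ ((VP t y).1 h)).
have VI p : I p <-> pullback V p.
  split=> [|Vp]; last by apply: (ideal_embed_coord II) => s; exact: (VP s _).1 (Vp s).
  have GI q : G q -> I q by move=> Gq; rewrite IG => J [_]; apply.
  rewrite IG => /(_ (pullback V)); apply; split; first exact: pullback_ideal.
  move=> q Gq; have [i [j /hcomp_id hq]] := homG q Gq.
  have cq := hcomp_congr_embed (i, j) q.
  rewrite -hq; apply: (pullback_congr (cq _ relation_ideal_annihilator)).
  apply/pullback_embed/VP/(congr_ideal idI (cq _ II)).
  by rewrite hq; exact: GI.
by exists V => //; apply/seteqP; split=> p /VI.
Qed.

End GradedIdeals.

(** * Standard subproduct systems as complements of graded ideals *)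
Section StandardSystems.
Variables (C : numClosedFieldType) (m n : nat).
Variable u : 'Hom(ell2 C ('I_n * 'I_m)%type, ell2 C ('I_m * 'I_n)%type).
Hypothesis cou : coisometric u.
Local Notation K := (@annihilator C m n u).

Definition orthocomplement (X : subspace_family C m n) : subspace_family C m n :=
  fun s => orthov (@inner C _) (X s).

Let idK := annihilator_ideal u.
Let Ku := @annihilator_comm C m n u.

Lemma Wop_unit_r s x :
  Wop u s (0, 0)%N x = relabel (fun a : words m n s * words m n (0, 0)%N =>
    cast_words (t := addd s (0, 0)%N) (unitd s) a.1) x.
Proof.
apply: (embed_congr_inj (u := u)); apply: (congr_trans idK (intertwines_Wop idK Ku x)).
apply/(congr_sym idK)/(intertwines_relabel idK) => a.
rewrite normal_word_cast -[LHS]mulr1; congr (_ * _); exact/esym/normal_word0.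
Qed.

Lemma Wop_unit_l s x :
  Wop u (0, 0)%N s x = relabel (fun a : words m n (0, 0)%N * words m n s =>
    a.2 : words m n (addd (0, 0)%N s)) x.
Proof.
apply: (embed_congr_inj (u := u)); apply: (congr_trans idK (intertwines_Wop idK Ku x)).
apply/(congr_sym idK)/(intertwines_relabel idK) => a.
apply: etrans (esym (mul1r _)) _; congr (_ * _); exact/esym/normal_word0.
Qed.

(** Both sides are the product of three factors in the quotient of the free algebra, so
    associativity is inherited from the free algebra by uniqueness of normal forms. *)
Lemma Wop_assoc s t r x :
  Wop u (addd s t) r (tensop (Wop u s t) \1%VF x) =
  relabel (cast_words (s := addd s (addd t r)) (t := addd (addd s t) r) (assocd s t r))
    (Wop u s (addd t r) (tensop \1%VF (Wop u t r)
      (relabel (fun a : (words m n s * words m n t) * words m n r =>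
               (a.1.1, (a.1.2, a.2))) x))).
Proof.
have f1 := intertwines_comp idK (@intertwines_Wop _ _ _ _ _ idK Ku (addd s t) r)
  (intertwines_tensop idK (@intertwines_Wop _ _ _ _ _ idK Ku s t)
    (intertwines_id idK (@normal_word C m n r))).
have f2 := intertwines_comp idK (@intertwines_Wop _ _ _ _ _ idK Ku s (addd t r))
  (intertwines_tensop idK (intertwines_id idK (@normal_word C m n s))
    (@intertwines_Wop _ _ _ _ _ idK Ku t r)).
apply: (embed_congr_inj (u := u)).
have := f1 x; rewrite comp_lfunE => e1; apply: (congr_trans idK e1).
set y := relabel _ x.
have e3 : K (lincomb (fun a : words m n s * (words m n t * words m n r) =>
     normal_word C a.1 * (normal_word C a.2.1 * normal_word C a.2.2)) y -
   lincomb (fun a : (words m n s * words m n t) * words m n r =>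
     (normal_word C a.1.1 * normal_word C a.1.2) * normal_word C a.2) x).
  by apply: (intertwines_relabel idK) => -[[a b] c]; exact: mulrA.
have := f2 y; rewrite comp_lfunE => e2.
apply/(congr_sym idK)/(congr_trans idK _ (congr_trans idK e2 e3)).
apply: (intertwines_relabel idK) => a.
exact: normal_word_cast.
Qed.

(** Transport along an equality of degrees; the equality is eliminated after splitting
    the degrees into variables. *)
Lemma cast_oproj (X : subspace_family C m n) s t (e : (s.1 = t.1) * (s.2 = t.2)) x :
  oproj (X t) (relabel (cast_words e) x) = relabel (cast_words e) (oproj (X s) x).
Proof.
case: s t e x => [i j] [i' j'] [/= e1 e2]; case: i' / e1; case: j' / e2 => x.
have -> : relabel (cast_words (s := (i, j)) (t := (i, j)) (erefl i, erefl j)) =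
    \1%VF :> 'End(ell2 C (words m n (i, j))).
  by apply: eq_lfun_delta => -[a b]; rewrite relabel_delta id_lfunE.
by rewrite !id_lfunE.
Qed.

Lemma cast_mem (X : subspace_family C m n) s t (e : (s.1 = t.1) * (s.2 = t.2)) x :
  x \in X s -> relabel (cast_words e) x \in X t.
Proof. by move=> xX; rewrite -(oproj_id xX) -cast_oproj oproj_mem. Qed.

(** The two domination axioms say that the complements form an ideal. Given this, the
    axioms of a subproduct system follow: coisometry from [coisometry_compression], the
    unit laws and associativity from those of [Wop]. *)
Lemma standardP X : standard_subproduct_system u X <->
  X (0, 0)%N = fullv /\ graded_ideal u (orthocomplement X).
Proof.
have coW s t := coisometric_Wop cou s t.
split=> [[[X0 _ _ _ _] leL leR]|[X0 gX]].
  split=> // s t x y; split.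
    by have /(le_op_tensorl _ (coW s t)) := leL s t; apply.
  by have /(le_op_tensorr _ (coW s t)) := leR s t; apply.
have gL s t x y := (gX s t x y).1; have gR s t x y := (gX s t x y).2.
have leL s t := (le_op_tensorl (X (addd s t)) (coW s t) (X s)).2 (gL s t).
have leR s t := (le_op_tensorr (X (addd s t)) (coW s t) (X t)).2 (gR s t).
split=> //; split=> // [s t|s|s|s t r].
- by apply: coisometry_compression => // x y; [exact: gL|exact: gR].
- move=> x xX; rewrite comp_lfunE Wop_unit_r; apply: oproj_id.
  move: x xX; apply: tensv_ind => [|c x y xX yX|x y xX _].
  - by rewrite linear0 mem0v.
  - by rewrite linearP; apply: memvD; [exact: memvZ|].
  - rewrite [y]ell2_words0 !linearZ; apply: memvZ.
    by rewrite /= (relabel_tensor_fst (cast_words _)); exact: cast_mem.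
- case: s => i j x xX; rewrite comp_lfunE Wop_unit_l; apply: oproj_id.
  move: x xX; apply: tensv_ind => [|c x y xX yX|x y _ yX].
  - by rewrite linear0 mem0v.
  - by rewrite linearP; apply: memvD; [exact: memvZ|].
  - rewrite [x]ell2_words0 tensorrE !linearZ; apply: memvZ.
    rewrite /= -tensorrE (relabel_tensor_snd (fun a => a)).
    suff : relabel id y \in X (i, j) by [].
    by rewrite relabel_id id_lfunE.
- move=> x _; cbv beta.
  (* The inner projections are absorbed by the outer ones. *)
  rewrite !(comp_lfunE (oproj _)) tensop_compl tensop_compr.
  rewrite (comp_lfunE (tensop (oproj _) _)) (comp_lfunE (tensop _ (oproj _))).
  rewrite (oproj_tensorl (gL _ _)) (oproj_tensorr (gR _ _)).
  by rewrite Wop_assoc cast_oproj.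
Qed.

End StandardSystems.

Local Open Scope classical_set_scope.

Theorem theorem4p4 (R : realType) (m n : nat)
  (u : 'Hom(ell2 (R[i]) ('I_n * 'I_m)%type, ell2 (R[i]) ('I_m * 'I_n)%type))
  (hu : unitary_op u) :
  exists Phi : subspace_family (R[i]) m n -> set (ncpoly (R[i]) m n),
    set_bij [set X | standard_subproduct_system u X]
            [set I | [/\ proper_two_sided_ideal I, homogeneous_ideal I &
                         forall i j, I (commutation_poly u i j)]]
            Phi /\
    (forall X X' : subspace_family (R[i]) m n,
       standard_subproduct_system u X -> standard_subproduct_system u X' ->
       (subsystem X X' <-> Phi X' `<=` Phi X)).
Proof.
have cou : coisometric u by case: hu.
pose Phi (X : subspace_family (R[i]) m n) := pullback u (orthocomplement X).
have orderPhi X X' : subsystem X X' <-> Phi X' `<=` Phi X.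
  rewrite /Phi pullbackS; split=> le s; first exact/orthovS/le.
  by rewrite -(orthovK (X s)) -(orthovK (X' s)); exact/orthovS/le.
have dperp V : orthocomplement (orthocomplement V) = V.
  by apply: functional_extensionality_dep => s; exact: orthovK.
exists Phi; split; last by move=> X X' _ _; exact: orderPhi.
split=> [X /(standardP cou)[X0 gX]|X X' _ _ ePhi|I /= [[idI prI] homI Iu]].
- split; last exact: (pullback_relation_ideal gX).2.
    split; first exact: pullback_ideal.
    by apply: (pullback_proper gX).2; rewrite /orthocomplement X0 orthov_fullv.
  exact: pullback_homogeneous.
- have [le le'] : subsystem X X' /\ subsystem X' X by split; apply/orderPhi; rewrite ePhi.
  by apply: functional_extensionality_dep => s; apply/eqP;
    rewrite eqEsubv; apply/andP; split; [exact: le|exact: le'].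
- have [V gV IV] := homogeneous_ideal_pullback (conj idI Iu) homI.
  exists (orthocomplement V); last by rewrite /Phi dperp.
  apply/(standardP cou); rewrite dperp; split=> //.
  have /(pullback_proper gV) V0 : pullback u V <> setT by rewrite -IV.
  by rewrite /orthocomplement V0 orthov0.
Qed.
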